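(* Let $f:\mathcal C\to\mathbb R^n$ be globally Lipschitz with $f(0)=0$, and let $\mathcal D:\mathcal C\to\mathbb R^n$, $\mathcal D\phi=\phi(0)-\sum_{j=1}^pA_j\phi(-\Delta_j)$, be strongly stable. Then the system described by $$\frac{d}{dt}\mathcal Dx_t=f(x_t),\quad t\ge 0,\qquad x(\tau)=\xi_0(\tau),\ \tau\in[-\Delta,0],\ \xi_0\in\mathcal C,$$ is $0$-GES if and only if there exist a globally Lipschitz functional $V:\mathcal C\to\mathbb R^+$ and positive reals $a_1,a_2,a_3$ such that the following conditions hold for all $\phi\in\mathcal C$: (i) $a_1|\mathcal D\phi|\le V(\phi)\le a_2\|\phi\|$; (ii) $D^+V(\phi)\le-a_3V(\phi)$.
   Context: Notation. $\mathbb R^+=[0,+\infty)$; $|\cdot|$ is the Euclidean norm on $\mathbb R^n$; $n,p$ are positive integers; $\Delta>0$ is real; $0<\Delta_j\le\Delta$ are reals and $A_j\in\mathbb R^{n\times n}$, $j=1,\dots,p$. $\mathcal C$ is the Banach space of continuous functions $[-\Delta,0]\to\mathbb R^n$ with the supremum norm $\|\cdot\|$. For a function $x$ on $[-\Delta,c)$ and $t\in[0,c)$, $x_t\in\mathcal C$ is $x_t(\tau)=x(t+\tau)$, $\tau\in[-\Delta,0]$. A solution on $[0,b)$ is a continuous $x:[-\Delta,b)\to\mathbb R^n$ with $x_0=\xi_0$ such that $t\mapsto\mathcal Dx_t$ is continuously differentiable and satisfies the equation (one-sided derivative at $t=0$). Strong stability. $\mathcal D$ is strongly stable (Hale and Lunel)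 if for every choice of positive delays $r_1,\dots,r_p$ the zero solution of the difference equation $y(t)=\sum_{j=1}^pA_jy(t-r_j)$ is uniformly asymptotically stable; equivalently, $\sup\{\rho(\sum_{j=1}^pA_je^{i\theta_j}):\theta_j\in[0,2\pi]\}<1$, where $\rho$ is the spectral radius. Lipschitz notion. A map $Q$ on $\mathcal C$ is globally Lipschitz if there is $L>0$ with $|Q(\phi_1)-Q(\phi_2)|\le L\|\phi_1-\phi_2\|$ for all $\phi_1,\phi_2\in\mathcal C$. 0-GES. The system is $0$-GES if there exist positive reals $M,\lambda$ such that, for any $\xi_0\in\mathcal C$, the corresponding solution exists for all $t\in\mathbb R^+$ and satisfies $|x(t)|\le Me^{-\lambda t}\|\xi_0\|$ for all $t\ge0$. Derivative. For (locally) Lipschitz $V:\mathcal C\to\mathbb R^+$, $D^+V:\mathcal C\to[-\infty,+\infty]$ is $$D^+V(\phi)=\limsup_{h\to0^+}\frac{V(\phi_h)-V(\phi)}{h},$$ where, for $0<h<\Delta$, $\phi_h\in\mathcal C$ is given by $\phi_h(s)=\phi(s+h)$ for $s\in[-\Delta,-h]$ and $\phi_h(s)=\mathcal D\phi+f(\phi)(s+h)-\mathcal D\phi^\star_{s+h}+\phi(0)$ for $s\in(-h,0]$; and, for $0<\theta\le h$, $\phi^\star_\theta\in\mathcal C$ is given by $\phi^\star_\theta(s)=\phi(s+\theta)$ for $s\in[-\Delta,-\theta]$ and $\phi^\star_\theta(s)=\phi(0)$ for $s\in(-\theta,0]$. *)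

(* Defs.v *)
From HB Require Import structures.
From mathcomp Require Import all_boot all_order all_algebra.
From mathcomp Require Import all_classical all_reals all_analysis.

Set Implicit Arguments.
Unset Strict Implicit.
Unset Printing Implicit Defensive.

Import Order.TTheory GRing.Theory Num.Theory.
Import numFieldNormedType.Exports.

Local Open Scope classical_set_scope.
Local Open Scope ring_scope.

(* The library norm `|v| on 'cV[R]_n is the max norm; it induces the same
   topology as this one. *)
Definition enorm (R : realType) (n : nat) (v : 'cV[R]_n) : R :=
  Num.sqrt (\sum_i v i ord0 ^+ 2).

(* The space C([-d, 0], R^n). An element is represented by a total function
   R -> 'cV[R]_n of which only the restriction to [-d, 0] matters. A functional
   on the space is a map on total functions; when it is globally Lipschitz in
   the sense below it takes the same value at two functions that agree on
   [-d, 0], because their supnorm distance is 0. *)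
Definition Cspace (R : realType) (n : nat) (d : R) : set (R -> 'cV[R]_n) :=
  [set phi | {within `[- d, 0], continuous phi}].
Arguments Cspace {R} n d.

Definition supnorm (R : realType) (n : nat) (d : R) (phi : R -> 'cV[R]_n) : R :=
  sup [set enorm (phi s) | s in `[- d, 0]].

Definition globally_lipschitz (R : realType) (n : nat) (d : R) (U : zmodType)
    (normU : U -> R) (Q : (R -> 'cV[R]_n) -> U) : Prop :=
  exists2 L : R, 0 < L &
    forall phi1 phi2, Cspace n d phi1 -> Cspace n d phi2 ->
      normU (Q phi1 - Q phi2) <= L * supnorm d (phi1 \- phi2).

(* The history segment x_t. *)
Definition segment_at (R : realType) (n : nat) (x : R -> 'cV[R]_n) (t : R) :
    R -> 'cV[R]_n :=
  fun tau => x (t + tau).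

Definition Dop (R : realType) (n p : nat) (A : 'I_p -> 'M[R]_n) (r : 'I_p -> R)
    (phi : R -> 'cV[R]_n) : 'cV[R]_n :=
  phi 0 - \sum_(j < p) A j *m phi (- r j).

Definition max_delay (R : realType) (p : nat) (r : 'I_p -> R) : R :=
  \big[Num.max/0]_(j < p) r j.

(* Continuous solutions, from the initial time sigma on, of
   y(t) = \sum_j A_j y(t - r_j). The equation at t = sigma is the usual
   compatibility condition on the initial segment y_sigma. *)
Definition difference_solution (R : realType) (n p : nat) (A : 'I_p -> 'M[R]_n)
    (r : 'I_p -> R) (sigma : R) (y : R -> 'cV[R]_n) : Prop :=
  {within `[sigma - max_delay r, +oo[, continuous y} /\
  forall t, sigma <= t -> y t = \sum_(j < p) A j *m y (t - r j).

Definition difference_UAS (R : realType) (n p : nat) (A : 'I_p -> 'M[R]_n)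
    (r : 'I_p -> R) : Prop :=
  let nrm y t := supnorm (max_delay r) (segment_at y t) in
  (forall eps : R, 0 < eps -> exists2 eta : R, 0 < eta &
     forall sigma y, difference_solution A r sigma y -> nrm y sigma < eta ->
       forall t, sigma <= t -> nrm y t < eps) /\
  (exists2 b : R, 0 < b &
     forall eps : R, 0 < eps -> exists2 T : R, 0 < T &
       forall sigma y, difference_solution A r sigma y -> nrm y sigma < b ->
         forall t, sigma + T <= t -> nrm y t < eps).

(* The delays of the operator play no role: all positive delays are considered,
   with the same matrices. *)
Definition strongly_stable (R : realType) (n p : nat) (A : 'I_p -> 'M[R]_n) :
    Prop :=
  forall r : 'I_p -> R, (forall j, 0 < r j) -> difference_UAS A r.

(* Solution on [0, +oo) of d/dt (D x_t) = f(x_t), x_0 = xi0, with D x_t of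
   class C^1: the last clause is the continuity of the derivative. *)
Definition neutral_solution (R : realType) (n p : nat) (Delta : R)
    (delta : 'I_p -> R) (A : 'I_p -> 'M[R]_n)
    (f : (R -> 'cV[R]_n) -> 'cV[R]_n) (xi0 x : R -> 'cV[R]_n) : Prop :=
  let Dx t := Dop A delta (segment_at x t) in
  [/\ {within `[- Delta, +oo[, continuous x},
      {in `[- Delta, 0], x =1 xi0},
      forall t : R, 0 < t -> is_derive t (1 : R) Dx (f (segment_at x t)),
      h^-1 *: (Dx h - Dx 0) @[h --> (0 : R)^'+] --> f (segment_at x 0) &
      {within `[0, +oo[, continuous (fun t : R => f (segment_at x t))}].

(* Existence of a global solution is part of the property. Solutions are unique
   when f is globally Lipschitz and all delays are positive, so the
   quantification over x is over "the" solution. *)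
Definition zero_GES (R : realType) (n p : nat) (Delta : R) (delta : 'I_p -> R)
    (A : 'I_p -> 'M[R]_n) (f : (R -> 'cV[R]_n) -> 'cV[R]_n) : Prop :=
  exists M lambda : R, [/\ 0 < M, 0 < lambda &
    forall xi0, Cspace n Delta xi0 ->
      (exists x, neutral_solution Delta delta A f xi0 x) /\
      (forall x, neutral_solution Delta delta A f xi0 x ->
         forall t, 0 <= t ->
           enorm (x t) <= M * expR (- (lambda * t)) * supnorm Delta xi0)].

Definition phi_star (R : realType) (n : nat) (phi : R -> 'cV[R]_n) (theta : R) :
    R -> 'cV[R]_n :=
  fun s => if s <= - theta then phi (s + theta) else phi 0.

Definition phi_shift (R : realType) (n p : nat) (delta : 'I_p -> R)
    (A : 'I_p -> 'M[R]_n) (f : (R -> 'cV[R]_n) -> 'cV[R]_n)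
    (phi : R -> 'cV[R]_n) (h : R) : R -> 'cV[R]_n :=
  fun s => if s <= - h then phi (s + h)
           else Dop A delta phi + (s + h) *: f phi
                - Dop A delta (phi_star phi (s + h)) + phi 0.

Definition Dplus (R : realType) (n p : nat) (delta : 'I_p -> R)
    (A : 'I_p -> 'M[R]_n) (f : (R -> 'cV[R]_n) -> 'cV[R]_n)
    (V : (R -> 'cV[R]_n) -> R) (phi : R -> 'cV[R]_n) : \bar R :=
  limf_esup (fun h : R => ((V (phi_shift delta A f phi h) - V phi) / h)%:E)
            ((0 : R)^'+).

(* Main.v *)
From HB Require Import structures.
Require Import Defs.
From mathcomp Require Import all_boot all_order all_algebra.
From mathcomp Require Import all_classical all_reals all_analysis.
From mathcomp Require Import ring lra.

Set Implicit Arguments.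
Unset Strict Implicit.
Unset Printing Implicit Defensive.

Import Order.TTheory GRing.Theory Num.Theory.
Import numFieldNormedType.Exports.

Local Open Scope classical_set_scope.
Local Open Scope ring_scope.

(** Why the theorem holds.

    A solution is handled through two facts: [x] is continuous, and
    [D x_t = x t - sum_j A_j x (t - delta_j)] has right derivative [f x_t] at
    every [t >= 0] ([extended_solution]).  One-sided derivatives are all that
    the estimates need, because a continuous function whose increments satisfy
    [g (t + h) <= g t + o(h)] does not increase ([dini_nonincreasing]).
    Elements of C are replaced by functions continuous on the whole line, by
    freezing the time outside [[-Delta, 0]], and the Euclidean norm by the
    maximum norm, which changes the constants only.

    All growth estimates use weights [expR (g * t)].  For large [g] both parts
    of the equation contract in the weighted norm: the integral of [f] gains
    [1 / g] and the difference part gains [expR (- g * dm)], where [dm > 0]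
    bounds the delays from below.  This gives global solutions by Picard iteration
    ([neutral_solution_exists]), and Lipschitz dependence on the initial
    function at an exponential rate ([solution_dependence]).

    From a Lyapunov functional to 0-GES.  The function [phi_h] in the
    definition of [D^+ V] differs from the true segment [x_h] by [o(h)]
    uniformly on [[-Delta, 0]] ([phi_shift_solution]), and [V] is Lipschitz, so
    [V x_t] decays like [expR (- a3 * t)] ([lyapunov_decay]).  By condition (i)
    the same holds for [u t = D x_t].  Hence [x] solves the difference equation
    [x t = sum_j A_j x (t - delta_j) + u t] with exponentially small forcing,
    and strong stability, at the delays [delta_j], has to be transferred
    from the homogeneous to the forced equation.  Asymptotic stability is
    known for continuous solutions, whose initial functions are compatible with
    the homogeneous equation; the history of [x] in general is not.  The remedy is
    to split [x = z + w], where [w] starts from zero and is forced by [u]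
    multiplied by a ramp which reaches 1 at time [dm]: then [z] is
    continuous and solves the homogeneous equation after that time.  So over a window of fixed
    length the norm of the history is halved, up to a multiple of the size of
    [u] ([forced_window]); iteration over windows gives the exponential rate
    ([forced_decay]).

    From 0-GES to a Lyapunov functional.  Put
    [V phi = sup_(t >= - Delta) expR (l * t) * `|x t|], where [x] is the
    solution that starts from [phi] and [l] is half of the decay rate.  This is
    comparable to the norm of [phi], and the flow property gives
    [V x_h <= expR (- l * h) * V phi], hence the decay of [V] along [D^+].
    The Lipschitz property is the delicate point, since nearby solutions may
    separate exponentially.  But after a time [T] that does not depend
    on [phi] the weighted norm of a solution lies below its values on
    [[-Delta, 0]], so only [t <= T] matters, where solutions depend on the
    initial function in a Lipschitz way ([flow_functional_lipschitz]). *)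

(** Matrices over the reals are complete as uniform spaces and normed; Picard
    iterates of column vectors need both structures at once. *)
HB.instance Definition _ (R : realType) (m n : nat) :=
  Uniform_isComplete.Build 'M[R]_(m, n) cauchy_cvg.

(** * One-sided differential inequalities *)

Lemma continuous_distP (R : realType) (V : normedModType R) (y : R -> V) (t : R) :
  {for t, continuous y} <->
  forall e : R, 0 < e -> exists2 eta : R, 0 < eta &
    forall s, `|s - t| < eta -> `|y s - y t| <= e.
Proof.
split=> [yt e e0|yt].
  have /nbhs_ballP[r /= r0 yr] : \forall s \near t, `|y t - y s| <= e.
    by move/cvgrPdist_le : yt; apply.
  exists r => // s st; rewrite distrC; apply: yr.
  by rewrite distrC in st; exact: st.
apply/cvgrPdist_le => e e0; have [r r0 yr] := yt e e0.
apply/nbhs_ballP; exists r => // s ts.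
by rewrite distrC; apply: yr; rewrite distrC; exact: ts.
Qed.

(** Suppose [g t > g 0 + e], and let [c] be the last time in [[0, t]] at which
    [g] is below the line of slope [e / t] through [(0, g 0)].  The hypothesis at
    [c], with half of that slope, keeps [g] below the line a little longer. *)
Lemma dini_nonincreasing (R : realType) (g : R -> R) :
  continuous g ->
  (forall t, 0 <= t -> forall e, 0 < e -> exists2 eta : R, 0 < eta &
     forall h, 0 < h < eta -> g (t + h) <= g t + e * h) ->
  forall t, 0 <= t -> g t <= g 0.
Proof.
move=> cg dg t t0; apply/ler_addgt0Pr => e e0; rewrite leNgt; apply/negP => gt.
have {}t0 : 0 < t.
  rewrite lt_neqAle t0 andbT; apply/eqP => t0'.
  by move: gt; rewrite -t0' ltNge lerDl ltW.
(* slope of the line that [g] is compared with *)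
pose b := e / t; have b0 : 0 < b by rewrite divr_gt0.
have bt : b * t = e by rewrite /b divfK// gt_eqF.
pose k s := g s - g 0 - b * s.
pose S := [set s | 0 <= s <= t /\ k s <= 0].
have S0 : S 0.
  by split; [rewrite lexx ltW|rewrite /k subrr mulr0 subr0].
have supS : has_sup S.
  by split; [exists 0|exists t => s [/andP[_ st] _]].
pose c := sup S.
have c0 : 0 <= c by exact: sup_upper_bound supS _ S0.
have ct : c <= t by apply: ge_sup; [exists 0|move=> s [/andP[]]].
have kc : k c <= 0.
  rewrite leNgt; apply/negP => kc0.
  have [r r0 gr] := (continuous_distP _ _).1 (cg c) _ (divr_gt0 kc0 (ltr0n _ 4)).
  have [s [/andP[s0 st] ks] cs] := sup_adherent r0 supS.
  have sc : s <= c by apply: sup_upper_bound => //; split => //; exact/andP.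
  have /gr : `|s - c| < r.
    by rewrite distrC ger0_norm ?subr_ge0// ltrBlDr -ltrBlDl.
  rewrite distrC ler_norml => /andP[_ gs].
  have : 0 <= b * (c - s) by rewrite mulr_ge0 ?subr_ge0// ltW.
  by move: ks kc0 gs; rewrite /k; lra.
have {}ct : c < t.
  rewrite lt_neqAle ct andbT; apply/eqP => ctE.
  by move: kc; rewrite ctE /k bt; lra.
have [r r0 gr] := dg c c0 (b / 2) (divr_gt0 b0 (ltr0n _ 2)).
pose h := Num.min (r / 2) (t - c).
have h0 : 0 < h by rewrite lt_min divr_gt0// subr_gt0.
have hr : h < r by rewrite gt_min; apply/orP; left; lra.
have ht : h <= t - c by rewrite ge_min lexx orbT.
have gh := gr h; rewrite h0 hr in gh; have {}gh := gh isT.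
have : S (c + h).
  split; first by apply/andP; split; lra.
  by move: kc gh; rewrite /k; nra.
by move/(sup_upper_bound supS); rewrite -/c; lra.
Qed.

(** The increment form is the one in which every estimate below uses
    differentiability; no quotient by [h] has to be formed. *)
Definition right_derivative_at (R : realType) (V : normedModType R)
    (u : R -> V) (t : R) (d : V) : Prop :=
  forall e, 0 < e -> exists2 eta : R, 0 < eta &
    forall h, 0 < h < eta -> `|u (t + h) - u t - h *: d| <= e * h.

Lemma is_derive_right (R : realType) (V : normedModType R) (u : R -> V) (t : R) d :
  is_derive t (1 : R) u d -> right_derivative_at u t d.
Proof.
move=> [du <-] e e0.
have /cvgrPdist_le /(_ e e0) : h^-1 *: (u (h *: 1 + t) - u t) @[h --> 0^'] --> 'D_1 u t.
  exact: du.
case=> r /= r0 ur; exists r => // h /andP[h0 hr].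
have := ur h; rewrite /= sub0r normrN gtr0_norm// => /(_ hr).
rewrite gt_eqF// => /(_ isT).
rewrite distrC -[h *: 1]/(h * 1) mulr1 (addrC h t) => uh.
have -> : u (t + h) - u t - h *: 'D_1 u t = h *: (h^-1 *: (u (t + h) - u t) - 'D_1 u t).
  by rewrite scalerBr scalerA divff ?gt_eqF// scale1r.
by rewrite normrZ gtr0_norm// mulrC ler_wpM2r// ltW.
Qed.

Lemma right_derivative_cvg (R : realType) (V : normedModType R) (u : R -> V) d :
  right_derivative_at u 0 d <-> h^-1 *: (u h - u 0) @[h --> (0 : R)^'+] --> d.
Proof.
split=> [ud|ud e e0].
  apply/cvgrPdist_le => e e0; have [r r0 ur] := ud e e0.
  near=> h.
  have h0 : 0 < h by near: h; exact: nbhs_right_gt.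
  have hr : h < r by near: h; exact: nbhs_right_lt.
  have := ur h; rewrite h0 hr add0r => /(_ isT) uh.
  have -> : d - h^-1 *: (u h - u 0) = - h^-1 *: (u h - u 0 - h *: d).
    by rewrite scaleNr [in RHS]scalerBr scalerA mulVf ?gt_eqF// scale1r opprB.
  by rewrite normrZ normrN gtr0_norm ?invr_gt0// ler_pdivrMl// mulrC.
move/cvgrPdist_le : ud => /(_ e e0) [r /= r0 ur].
exists r => // h /andP[h0 hr].
have := ur h; rewrite /= sub0r normrN gtr0_norm// => /(_ hr h0) uh.
have -> : u (0 + h) - u 0 - h *: d = - h *: (d - h^-1 *: (u h - u 0)).
  by rewrite add0r scaleNr scalerBr scalerA divff ?gt_eqF// scale1r opprB.
by rewrite normrZ normrN gtr0_norm// mulrC ler_wpM2r// ltW.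
Unshelve. all: by end_near. Qed.

Lemma subrACA (V : zmodType) (x y z t : V) : (x - y) - (z - t) = (x - z) - (y - t).
Proof. by rewrite opprD addrACA -opprD. Qed.

Lemma right_derivativeB (R : realType) (V : normedModType R) (u v : R -> V) t d e :
  right_derivative_at u t d -> right_derivative_at v t e ->
  right_derivative_at (u \- v) t (d - e).
Proof.
move=> ud ve eps eps0.
have e20 : 0 < eps / 2 by rewrite divr_gt0.
have [r r0 ur] := ud _ e20; have [s s0 vs] := ve _ e20.
exists (Num.min r s) => [|h /andP[h0]]; first by rewrite lt_min r0.
rewrite lt_min => /andP[hr hs].
have := ur h; rewrite h0 hr => /(_ isT) {}ur.
have := vs h; rewrite h0 hs => /(_ isT) {}vs.
have -> : (u \- v) (t + h) - (u \- v) t - h *: (d - e) =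
    (u (t + h) - u t - h *: d) - (v (t + h) - v t - h *: e).
  by rewrite /= scalerBr (subrACA (u _) (v _)) (subrACA (u _ - _)).
by apply: le_trans (ler_normB _ _) _; lra.
Qed.

(** This stands for the bound of the integral of [d] by that of
    [C * expR (g * s)]: the difference of the two sides, before the constant is
    dropped, has nonpositive right Dini derivative. *)
Lemma expR_mean_value (R : realType) (V : normedModType R) (u d : R -> V)
    (g C : R) :
  0 < g -> 0 <= C -> continuous u ->
  (forall t, 0 <= t -> right_derivative_at u t (d t)) ->
  (forall t, 0 <= t -> `|d t| <= C * expR (g * t)) ->
  forall t, 0 <= t -> `|u t - u 0| <= C / g * expR (g * t).
Proof.
move=> g0 C0 cu du dC t t0.
pose k t := `|u t - u 0| - C / g * expR (g * t).
suff : k t <= k 0.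
  rewrite /k subrr normr0 mulr0 expR0 => kt.
  have : 0 <= C / g by rewrite divr_ge0// ltW.
  lra.
apply: dini_nonincreasing t0 => {t}[|t t0 e e0].
  move=> t; apply: cvgB.
    by apply: cvg_norm; apply: cvgB; [exact: cu|exact: cvg_cst].
  apply: cvgM; first exact: cvg_cst.
  apply: (@continuous_comp _ _ _ ( *%R g) expR); last exact: continuous_expR.
  exact: mulrl_continuous.
have [r r0 ur] := du t t0 e e0; exists r => // h /[dup] h0 /ur {}ur.
have {}h0 : 0 < h by case/andP: h0.
have Cgh : C * expR (g * t) * h <= C / g * expR (g * (t + h)) - C / g * expR (g * t).
  rewrite mulrDr expRD -mulrA -mulrBr -[in leRHS]mulrA ler_wpM2l//.
  have := expR_ge1Dx (g * h); have := expR_gt0 (g * t).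
  set E := expR (g * t); set F := expR (g * h) => E0 F1.
  rewrite ler_pdivlMl//; nra.
have uh : `|u (t + h) - u 0| <= e * h + `|u t - u 0| + h * `|d t|.
  have -> : u (t + h) - u 0 = (u (t + h) - u t - h *: d t) + (u t - u 0) + h *: d t.
    by rewrite addrAC subrK addrA subrK.
  apply: le_trans (ler_normD _ _) _; rewrite normrZ (gtr0_norm h0) lerD2r.
  by apply: le_trans (ler_normD _ _) _; rewrite lerD2r.
have := dC t t0; rewrite /k => dt.
have : h * `|d t| <= C * expR (g * t) * h by rewrite mulrC ler_pM2r.
lra.
Qed.

(** The upper limit that defines [D^+ V], as a family of inequalities for small
    [h]; the Lyapunov decay needs one direction, the converse the other. *)
Lemma limf_esup_right_leP (R : realType) (F : R -> R) (c : R) :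
  (limf_esup (fun h => (F h)%:E) ((0 : R)^'+) <= c%:E)%E <->
  forall e : R, 0 < e -> exists2 eta : R, 0 < eta &
    forall h, 0 < h < eta -> F h <= c + e.
Proof.
rewrite limf_esupE; split=> [Fc e e0|Fc].
  have : (ereal_inf [set ereal_sup ((fun h => (F h)%:E) @` W) | W in (0 : R)^'+]
      < (c + e)%:E)%E.
    by apply: le_lt_trans Fc _; rewrite lte_fin ltrDl.
  move=> /ereal_inf_lt[_ [W W0 <-]] /ltW FW.
  case: W0 => r /= r0 Wr; exists r => // h /andP[h0 hr].
  rewrite -lee_fin; apply: le_trans FW; apply: ereal_sup_ubound.
  exists h => //; apply: Wr => //=.
  by rewrite sub0r normrN gtr0_norm.
apply/lee_addgt0Pr => e e0; have [r r0 Fr] := Fc e e0.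
apply: ge_ereal_inf; exists (ereal_sup ((fun h => (F h)%:E) @` [set h | 0 < h < r])).
  exists [set h | 0 < h < r] => //.
  near=> h; rewrite /=; apply/andP; split; near: h.
    exact: nbhs_right_gt.
  exact: nbhs_right_lt.
apply: ge_ereal_sup => _ [h /= hr <-].
by rewrite -EFinD lee_fin; exact: Fr.
Unshelve. all: by end_near. Qed.

(** * Contraction in exponentially weighted norms *)

Lemma geometric_small (R : realType) (q B e : R) :
  0 <= q < 1 -> 0 < e -> exists k, q ^+ k * B <= e.
Proof.
move=> /andP[q0 q1] e0.
have q1' : `|q| < 1 by rewrite ger0_norm.
have /cvgrPdist_le /(_ e e0) [k _ /(_ k (leqnn _))] := cvg_geometric B q1'.
rewrite /= sub0r normrN => h; exists k; apply: le_trans h.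
by rewrite mulrC ler_norm.
Qed.

Lemma geometric_le0 (R : realType) (q B a : R) :
  0 <= q < 1 -> (forall k, a <= q ^+ k * B) -> a <= 0.
Proof.
move=> q01 aq; apply/ler_addgt0Pr => e e0; rewrite add0r.
by have [k /(le_trans (aq k))] := geometric_small B q01 e0.
Qed.

Lemma geometric_cauchy_cvg (R : realType) (V : completeNormedModType R)
    (u : nat -> V) (q B : R) :
  0 <= q < 1 -> (forall k j, `|u (k + j)%N - u k| <= q ^+ k * B) ->
  exists l, forall k, `|l - u k| <= q ^+ k * B.
Proof.
move=> q01 uq.
have cu : cvg (u @ \oo).
  apply: cauchy_cvg; apply: cauchy_exP => e e0.
  have [k ke] := geometric_small B q01 (divr_gt0 e0 (ltr0n R 2)).
  exists (u k); exists k => // m /= km; rewrite -ball_normE /ball_/= distrC.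
  rewrite -(subnKC km); apply: le_lt_trans (uq _ _) _; apply: le_lt_trans ke _.
  by rewrite ltr_pdivrMr// ltr_pMr// ltr1n.
exists (lim (u @ \oo)) => k; apply/ler_addgt0Pr => e e0.
have /cvgrPdist_le : u k @[k --> \oo] --> lim (u @ \oo) by exact: cu.
move=> /(_ e e0) [m _ /(_ (k + m)%N (leq_addl _ _)) um].
rewrite -(subrK (u (k + m)%N) (lim _)) -addrA (le_trans (ler_normD _ _))//.
by rewrite [leRHS]addrC; apply: lerD => //; exact: uq.
Qed.

(** Picard iteration on the whole half-line.  The operator [T] keeps the past
    [t <= 0] fixed and contracts the weighted distance of two functions with the
    same past.  The iterates converge at a rate which is locally uniform in [t],
    so the limit is continuous; and it is fixed because [T] maps it to within
    [q ^+ k.+1] of the next iterate for every [k]. *)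
Lemma weighted_contraction (R : realType) (V : completeNormedModType R)
    (g q C0 : R) (y0 : R -> V) (T : (R -> V) -> (R -> V)) :
  0 <= g -> 0 <= q < 1 -> 0 <= C0 -> continuous y0 ->
  (forall y : R -> V, continuous y -> continuous (T y)) ->
  (forall y : R -> V, continuous y -> (forall t : R, t <= 0 -> y t = y0 t) ->
     forall t : R, t <= 0 -> T y t = y0 t) ->
  (forall (y1 y2 : R -> V) (C : R), continuous y1 -> continuous y2 ->
     (forall t : R, t <= 0 -> y1 t = y2 t) -> 0 <= C ->
     (forall t : R, 0 <= t -> `|y1 t - y2 t| <= C * expR (g * t)) ->
     forall t : R, 0 <= t -> `|T y1 t - T y2 t| <= q * C * expR (g * t)) ->
  (forall t : R, 0 <= t -> `|T y0 t - y0 t| <= C0 * expR (g * t)) ->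
  exists x, [/\ continuous x, forall t : R, t <= 0 -> x t = y0 t,
    forall t : R, T x t = x t &
    forall t : R, 0 <= t -> `|x t - y0 t| <= C0 / (1 - q) * expR (g * t)].
Proof.
move=> g0 /[dup] q01 /andP[q0 q1] C00 cy0 cT T0 Tq T1.
pose y k := iter k T y0.
have cy k : continuous (y k) by elim: k => //= k; exact: cT.
have yn k t : t <= 0 -> y k t = y0 t.
  by elim: k t => //= k IH t t0; apply: T0 => //; exact: cy.
have q1' : 0 < 1 - q by rewrite subr_gt0.
have yS k t : 0 <= t -> `|y k.+1 t - y k t| <= q ^+ k * C0 * expR (g * t).
  elim: k t => [|k IH] t t0; first by rewrite expr0 mul1r T1.
  rewrite exprS -(mulrA q); apply: (Tq (y k.+1) (y k)) => // [s s0|].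
    by rewrite !yn.
  by rewrite mulr_ge0// exprn_ge0.
have [B BE] : exists B, B = C0 / (1 - q) by exists (C0 / (1 - q)).
have B0 : 0 <= B by rewrite BE divr_ge0// ltW.
have C0E : C0 = B - q * B by rewrite BE; field; rewrite gt_eqF.
have B0k k s : 0 <= q ^+ k * (B * expR (g * s)).
  by rewrite mulr_ge0 ?exprn_ge0// mulr_ge0 ?expR_ge0.
have yD k j t : `|y (k + j)%N t - y k t| <= q ^+ k * (B * expR (g * t)).
  have [t0|/ltW t0] := leP t 0.
    by rewrite !yn// subrr normr0.
  have qj : 1 - q ^+ j <= 1 by rewrite gerBl exprn_ge0.
  (* the partial sum of the geometric series makes the induction on [j] close *)
  suff h : `|y (k + j)%N t - y k t| <= (1 - q ^+ j) * (q ^+ k * (B * expR (g * t))).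
    by apply: le_trans h _; rewrite ler_piMl.
  elim: j {qj} => [|j IH]; first by rewrite addn0 subrr normr0 expr0 subrr mul0r.
  rewrite -(subrK (y (k + j)%N t) (y (k + j.+1)%N t)) -addrA.
  apply: le_trans (ler_normD _ _) _.
  have := yS (k + j)%N t t0; rewrite addnS C0E exprD exprS.
  by move: IH; set a := `|_|; set b := `|_|; nra.
have [x xy] : exists x : R -> V, forall t k, `|x t - y k t| <= q ^+ k * (B * expR (g * t)).
  have /choice[x xP] : forall t, exists l, forall k, `|l - y k t| <= q ^+ k * (B * expR (g * t)).
    by move=> t; apply: geometric_cauchy_cvg => // k j; exact: yD.
  by exists x.
have xn t : t <= 0 -> x t = y0 t.
  move=> t0; apply/eqP; rewrite -subr_eq0 -normr_le0.
  by apply: (geometric_le0 q01) => k; rewrite -(yn k t t0); exact: xy.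
have cx : continuous x.
  move=> t; apply/continuous_distP => e e0.
  have e3 : 0 < e / 3 by rewrite divr_gt0.
  (* the iterates are uniformly close to the limit up to time [t + 1] *)
  have [k kB] := geometric_small (B * expR (g * (t + 1))) q01 e3.
  have [r r0 yr] := (continuous_distP _ _).1 (cy k t) _ e3.
  exists (Num.min r 1); first by rewrite lt_min r0 ltr01.
  move=> s; rewrite lt_min => /andP[/yr ys]; rewrite ltr_norml => /andP[_ st].
  have xyk w : w <= t + 1 -> `|x w - y k w| <= e / 3.
    move=> wt; apply: le_trans (xy w k) (le_trans _ kB).
    by rewrite !ler_wpM2l ?exprn_ge0// ler_expR ler_wpM2l.
  have -> : x s - x t = (x s - y k s) + (y k s - y k t) - (x t - y k t).
    by rewrite addrA subrK opprB addrA subrK.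
  apply: le_trans (ler_normB _ _) _; apply: le_trans (lerD (ler_normD _ _) (lexx _)) _.
  have := xyk s; have := xyk t; move: ys.
  set a := `|_|; set b := `|_|; set c := `|_| => ya hb hc.
  have := hb ltac:(lra); have := hc ltac:(lra); lra.
exists x; split => // [t|t t0]; last first.
  by apply: le_trans (xy t 0%N) _; rewrite expr0 mul1r BE.
have [t0|/ltW t0] := leP t 0; first by rewrite T0// xn.
apply/eqP; rewrite -subr_eq0 -normr_le0.
apply: (geometric_le0 (B := 2 * (B * expR (g * t))) q01) => k.
have h1 : `|T x t - y k.+1 t| <= q * (q ^+ k * B) * expR (g * t).
  apply: (Tq x (y k)) => // [s s0||s s0]; first by rewrite xn// yn.
    by rewrite mulr_ge0// exprn_ge0.
  by rewrite -mulrA; exact: xy.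
have h2 := xy t k.+1; rewrite exprS in h2.
have -> : T x t - x t = (T x t - y k.+1 t) - (x t - y k.+1 t).
  by rewrite opprB addrA subrK.
apply: le_trans (ler_normB _ _) _.
have := B0k k t.
by move: h1 h2; set a := `|_|; set b := `|_|; nra.
Qed.

(** The map [C |-> B + q * C] that improves a bound has the fixed point
    [B / (1 - q)], to which its iterates converge.  An initial finite bound is
    indispensable: this is where boundedness of solutions enters. *)
Lemma weighted_bound_improve (R : realType) (V : normedModType R)
    (g q B : R) (z : R -> V) :
  0 <= q < 1 -> 0 <= B ->
  (exists2 C, 0 <= C & forall t, 0 <= t -> `|z t| <= C * expR (g * t)) ->
  (forall C, 0 <= C -> (forall t, 0 <= t -> `|z t| <= C * expR (g * t)) ->
     forall t, 0 <= t -> `|z t| <= (B + q * C) * expR (g * t)) ->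
  forall t, 0 <= t -> `|z t| <= B / (1 - q) * expR (g * t).
Proof.
move=> /[dup] q01 /andP[q0 q1] B0 [C C0 zC] zq t t0.
have q1' : 0 < 1 - q by rewrite subr_gt0.
have [D DE] : exists D, D = B / (1 - q) by exists (B / (1 - q)).
have D0 : 0 <= D by rewrite DE divr_ge0// ltW.
have BE : B = D - q * D by rewrite DE; field; rewrite gt_eqF.
have zk k : forall s, 0 <= s -> `|z s| <= (D + q ^+ k * C) * expR (g * s).
  elim: k => [|k IH] s s0.
    apply: le_trans (zC s s0) _; rewrite ler_wpM2r ?expR_ge0//.
    by rewrite expr0 mul1r lerDr.
  have := zq (D + q ^+ k * C) _ IH s s0.
  rewrite (_ : B + q * _ = D + q ^+ k.+1 * C); last by rewrite exprS BE; ring.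
  by apply; rewrite addr_ge0// mulr_ge0// exprn_ge0.
rewrite -subr_le0; apply: (geometric_le0 (B := C * expR (g * t)) q01) => k.
by have := zk k t t0; rewrite -DE; lra.
Qed.

(** Continuity of [t |-> x_t] for the supremum norm, by compactness of
    [[-d, 0]]. *)
Lemma continuous_segment_uniform (R : realType) (V : normedModType R)
    (x : R -> V) (d t e : R) : continuous x -> 0 < e ->
  exists2 eta, 0 < eta & forall s, `|s - t| < eta ->
    forall tau, - d <= tau <= 0 -> `|x (s + tau) - x (t + tau)| <= e.
Proof.
move=> cx e0.
have /compact_near_coveringP cK := @segment_compact R (- d) 0.
have /(_ R (nbhs t) (fun s tau => `|x (s + tau) - x (t + tau)| <= e)) := cK.
case=> [tau _|r r0 xr].
- have [r r0 xr] := (continuous_distP _ _).1 (cx (t + tau)) _ (divr_gt0 e0 (ltr0n R 2)).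
  have r20 : 0 < r / 2 by rewrite divr_gt0.
  exists (ball tau (r / 2), ball t (r / 2)); first by split; exact: nbhsx_ballx.
  move=> [w s] [/=]; rewrite -ball_normE /ball_/= => tw ts.
  have h1 : `|x (s + w) - x (t + tau)| <= e / 2.
    apply: xr; rewrite (_ : s + w - _ = - (tau - w) - (t - s)); last by ring.
    by apply: le_lt_trans (ler_normB _ _) _; rewrite normrN; lra.
  have h2 : `|x (t + w) - x (t + tau)| <= e / 2.
    apply: xr; rewrite (_ : t + w - _ = - (tau - w)); last by ring.
    by rewrite normrN; lra.
  have -> : x (s + w) - x (t + w) = (x (s + w) - x (t + tau)) - (x (t + w) - x (t + tau)).
    by rewrite opprB addrA subrK.
  by apply: le_trans (ler_normB _ _) _; lra.
- exists r => // s st tau tau0; apply: xr; first by rewrite /ball_ distrC in st *.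
  by rewrite /= in_itv.
Qed.

(** * The space of initial functions *)

Lemma normv_entry (R : realType) (n : nat) (v : 'cV[R]_n) i : `|v i ord0| <= `|v|.
Proof.
by rewrite [leRHS]/Num.Def.normr/= mx_normrE; exact: (le_bigmax _ _ (i, ord0)).
Qed.

Lemma normv_le (R : realType) (n : nat) (v : 'cV[R]_n) c :
  0 <= c -> (forall i, `|v i ord0| <= c) -> `|v| <= c.
Proof.
move=> c0 vc; rewrite /Num.Def.normr/= mx_normrE (bigmax_le _ c0)//= => -[i j] _ /=.
by rewrite (ord1 j).
Qed.

Lemma normv_le_enorm (R : realType) (n : nat) (v : 'cV[R]_n) : `|v| <= enorm v.
Proof.
apply: normv_le => [|i]; first exact: sqrtr_ge0.
rewrite -sqrtr_sqr ler_wsqrtr// (bigD1 i)//= lerDl sumr_ge0// => j _.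
exact: sqr_ge0.
Qed.

Lemma enorm_le_normv (R : realType) (n : nat) (v : 'cV[R]_n) :
  enorm v <= n%:R * `|v|.
Proof.
rewrite -[leRHS]ger0_norm ?mulr_ge0// -sqrtr_sqr ler_wsqrtr//.
apply: (@le_trans _ _ (\sum_(i < n) `|v| ^+ 2)).
  apply: ler_sum => i _; rewrite -[leLHS]ger0_norm ?sqr_ge0// normrX lerXn2r ?nnegrE//.
  exact: normv_entry.
rewrite sumr_const card_ord -[leLHS]mulr_natl exprMn ler_wpM2r ?sqr_ge0// -natrX ler_nat.
by case: (n) => // k; rewrite expnS expn1 leq_pmulr.
Qed.

Lemma mulmx_sum_bound (R : realType) (n p : nat) (A : 'I_p -> 'M[R]_n) :
  exists2 a : R, 0 <= a & forall (w : 'I_p -> 'cV[R]_n) (m : R),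
    (forall j, `|w j| <= m) -> 0 <= m -> `|\sum_(j < p) A j *m w j| <= a * m.
Proof.
exists (\sum_(j < p) \sum_i \sum_k `|A j i k|).
  by do 3 (apply: sumr_ge0 => ? _).
move=> w m wm m0; apply: le_trans (ler_norm_sum _ _ _) _.
rewrite mulr_suml; apply: ler_sum => j _.
apply: normv_le => [|i].
  by rewrite mulr_ge0//; do 2 (apply: sumr_ge0 => ? _).
rewrite mxE; apply: le_trans (ler_norm_sum _ _ _) _.
apply: (@le_trans _ _ ((\sum_k `|A j i k|) * m)).
  rewrite mulr_suml; apply: ler_sum => k _; rewrite normrM ler_wpM2l//.
  exact: le_trans (normv_entry _ _) (wm j).
rewrite ler_wpM2r// [leRHS](bigD1 i)//= lerDl.
by do 2 (apply: sumr_ge0 => ? _).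
Qed.

Lemma continuous_mulmx (R : realType) (n : nat) (M : 'M[R]_n)
    (y : R -> 'cV[R]_n) :
  continuous y -> continuous (fun t => M *m y t).
Proof.
move=> cy t; have [a a0 aP] := mulmx_sum_bound (fun _ : 'I_1 => M).
apply/continuous_distP => e e0.
have a1 : 0 < a + 1 by rewrite ltr_wpDl.
have [r r0 yr] := (continuous_distP _ _).1 (cy t) _ (divr_gt0 e0 a1).
exists r => // s /yr ys; rewrite -mulmxBr.
have := aP (fun=> y s - y t) _ (fun=> lexx _) (normr_ge0 _).
rewrite big_ord1 => /le_trans; apply.
move: ys; rewrite ler_pdivlMr//; have := normr_ge0 (y s - y t); nra.
Qed.

Lemma continuous_maxl (R : realType) (c : R) :
  continuous (fun t : R => Num.max c t).
Proof.
by move=> t; apply: (@continuous_max R R (fun=> c) id); [exact: cvg_cst|exact: cvg_id].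
Qed.

Lemma continuous_minr (R : realType) (c : R) :
  continuous (fun t : R => Num.min t c).
Proof.
by move=> t; apply: (@continuous_min R R id (fun=> c)); [exact: cvg_id|exact: cvg_cst].
Qed.

(** Composition with a continuous retraction onto [A] is how functions that are
    continuous on an interval are extended to the whole line. *)
Lemma continuous_comp_within (R : realType) (V : normedModType R) (A : set R)
    (x : R -> V) (c : R -> R) :
  {within A, continuous x} -> continuous c -> (forall t, A (c t)) ->
  continuous (fun t => x (c t)).
Proof.
move=> /subspace_continuousP cx cc Ac t.
apply: cvg_comp (cx (c t) (Ac t)) => S wS.
have : nbhs t (c @^-1` [set s | A s -> S s]) by exact: (cc t _ wS).
by apply: filterS => s; exact.
Qed.

Lemma within_continuous_eq (R : realType) (V : normedModType R) (A : set R)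
    (x y : R -> V) :
  continuous y -> (forall t, A t -> x t = y t) -> {within A, continuous x}.
Proof.
move=> cy xy.
have : {within A, continuous y} by exact: continuous_subspaceT.
by apply: (@subspace_eq_continuous _ A _ y x) => t; rewrite inE => /xy /esym.
Qed.

(** The Lipschitz condition with a pointwise bound in place of the supremum
    norm.  With [m = 0] it says that [Q phi] depends on the restriction of [phi] to
    [[-d, 0]]. *)
Definition sup_lipschitz (R : realType) (n : nat) (d : R) (U : normedZmodType R)
    (L : R) (Q : (R -> 'cV[R]_n) -> U) : Prop :=
  forall phi1 phi2 m, Cspace n d phi1 -> Cspace n d phi2 ->
    (forall s, - d <= s <= 0 -> `|phi1 s - phi2 s| <= m) ->
    `|Q phi1 - Q phi2| <= L * m.

Lemma continuous_segment_at (R : realType) (n : nat) (x : R -> 'cV[R]_n) (t : R) :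
  continuous x -> continuous (segment_at x t).
Proof.
move=> cx s; apply: (@continuous_comp _ _ _ (fun s => t + s) x); last exact: cx.
by apply: cvgD; [exact: cvg_cst|exact: cvg_id].
Qed.

Section supnorm.
Context (R : realType) (n : nat) (d : R) (d0 : 0 <= d).
Implicit Types phi : R -> 'cV[R]_n.

Lemma Cspace_eq phi (y : R -> 'cV[R]_n) :
  continuous y -> (forall s, - d <= s <= 0 -> phi s = y s) -> Cspace n d phi.
Proof.
by move=> cy phiy; apply: within_continuous_eq cy _ => s /=; rewrite in_itv/=; exact: phiy.
Qed.

Lemma Cspace_extend phi : Cspace n d phi ->
  exists y, [/\ continuous y, forall s, - d <= s <= 0 -> y s = phi s,
    forall s, s <= - d -> y s = phi (- d) & forall s, 0 <= s -> y s = phi 0].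
Proof.
move=> cphi; exists (fun t => phi (Num.max (- d) (Num.min t 0))); split.
- apply: continuous_comp_within cphi _ _.
    move=> t; exact: (continuous_comp (continuous_minr (c := 0) (x := t))
      (continuous_maxl (c := - d) (x := Num.min t 0))).
  move=> t /=; rewrite in_itv/= le_max lexx/= ge_max oppr_le0 d0/=.
  by rewrite ge_min lexx orbT.
- by move=> s /andP[ds s0]; rewrite (min_idPl s0) (max_idPr ds).
- move=> s sd; have s0 : s <= 0 by apply: le_trans sd _; rewrite oppr_le0.
  by rewrite (min_idPl s0) (max_idPl sd).
- by move=> s s0; rewrite (min_idPr s0) max_r// oppr_le0.
Qed.

Lemma Cspace_bounded phi : Cspace n d phi ->
  exists2 m : R, 0 <= m & forall s, - d <= s <= 0 -> `|phi s| <= m.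
Proof.
move=> /Cspace_extend[y [cy yphi _ _]].
have cny : {within `[- d, 0], continuous (fun s => `|y s|)}.
  by apply: continuous_subspaceT => t; apply: cvg_norm; exact: cy.
have [|c _ yc] := EVT_max _ cny; first by rewrite oppr_le0.
by exists `|y c| => // s sd; rewrite -yphi//; apply: yc; rewrite in_itv.
Qed.

Lemma normv_le_supnorm phi s : Cspace n d phi -> - d <= s <= 0 ->
  `|phi s| <= supnorm d phi.
Proof.
move=> cphi ds; apply: le_trans (normv_le_enorm _) _; apply: ub_le_sup.
  have [m m0 pm] := Cspace_bounded cphi.
  exists (n%:R * m) => _ [r /= + <-]; rewrite in_itv/= => /pm pr.
  by apply: le_trans (enorm_le_normv _) _; rewrite ler_wpM2l.
by exists s => //=; rewrite in_itv.
Qed.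

Lemma supnorm_le phi m :
  (forall s, - d <= s <= 0 -> `|phi s| <= m) -> supnorm d phi <= n%:R * m.
Proof.
move=> pm; apply: ge_sup.
  by exists (enorm (phi 0)), 0 => //=; rewrite in_itv/= lexx oppr_le0 d0.
move=> _ [s /= + <-]; rewrite in_itv/= => /pm ps.
by apply: le_trans (enorm_le_normv _) _; rewrite ler_wpM2l.
Qed.

Lemma Cspace_segment_at (x : R -> 'cV[R]_n) t : continuous x ->
  Cspace n d (segment_at x t).
Proof.
by move=> cx; exact: (Cspace_eq (continuous_segment_at cx) (fun _ _ => erefl)).
Qed.

Lemma CspaceB phi1 phi2 : Cspace n d phi1 -> Cspace n d phi2 ->
  Cspace n d (phi1 \- phi2).
Proof.
move=> /Cspace_extend[y1 [c1 e1 _ _]] /Cspace_extend[y2 [c2 e2 _ _]].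
apply: (@Cspace_eq _ (y1 \- y2)) => [t|s sd /=]; last by rewrite e1// e2.
by apply: cvgB; [exact: c1|exact: c2].
Qed.

(** The factor [n%:R] in the constant is the price for passing from the
    Euclidean to the maximum norm. *)
Lemma globally_lipschitz_normv (U : normedZmodType R) (normU : U -> R)
    (Q : (R -> 'cV[R]_n) -> U) :
  (forall u, `|u| <= normU u) -> globally_lipschitz d normU Q ->
  exists2 L : R, 0 <= L & sup_lipschitz d L Q.
Proof.
move=> leU [L L0 QL]; exists (L * n%:R) => [|phi1 phi2 m c1 c2 pm].
  by rewrite mulr_ge0// ltW.
apply: le_trans (leU _) (le_trans (QL _ _ c1 c2) _).
by rewrite -mulrA ler_wpM2l ?(ltW L0)//; exact: supnorm_le.
Qed.

End supnorm.

Lemma supnorm_eq (R : realType) (n : nat) (d : R) (phi psi : R -> 'cV[R]_n) :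
  (forall s, - d <= s <= 0 -> phi s = psi s) -> supnorm d phi = supnorm d psi.
Proof.
move=> e; congr sup; apply/seteqP; split=> _ [s /= sd <-]; exists s => //;
  by rewrite in_itv/= in sd; rewrite e.
Qed.

Lemma lipschitz_eq (R : realType) (n : nat) (d L : R) (U : normedZmodType R)
    (Q : (R -> 'cV[R]_n) -> U) (phi1 phi2 : R -> 'cV[R]_n) :
  sup_lipschitz d L Q ->
  Cspace n d phi1 -> Cspace n d phi2 ->
  (forall s, - d <= s <= 0 -> phi1 s = phi2 s) -> Q phi1 = Q phi2.
Proof.
move=> QL c1 c2 e12; apply/eqP; rewrite -subr_eq0 -normr_le0.
rewrite -(mulr0 L); apply: QL => // s sd.
by rewrite e12// subrr normr0.
Qed.

Lemma continuous_lipschitz_segment (R : realType) (n : nat) (d L : R)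
    (U : normedModType R) (Q : (R -> 'cV[R]_n) -> U) (x : R -> 'cV[R]_n) :
  0 <= L ->
  sup_lipschitz d L Q ->
  continuous x -> continuous (fun t => Q (segment_at x t)).
Proof.
move=> L0 QL cx t; apply/continuous_distP => e e0.
have L1 : 0 < L + 1 by rewrite ltr_wpDl.
have [r r0 xr] := continuous_segment_uniform d t cx (divr_gt0 e0 L1).
exists r => // s /xr xs.
have Qs := QL _ _ _ (Cspace_segment_at cx) (Cspace_segment_at cx) xs.
apply: le_trans Qs _; rewrite mulrA ler_pdivrMr//; nra.
Qed.

(** * Antiderivatives of vector-valued functions *)

(** Integrating from [-1] makes [0] an interior point, so that the fundamental
    theorem of calculus gives a derivative there as well. *)
Lemma antiderivative_real (R : realType) (g : R -> R) : continuous g ->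
  exists F : R -> R, F 0 = 0 /\ forall t, 0 <= t -> derivable F t 1 /\ 'D_1 F t = g t.
Proof.
move=> cg.
have [G GP] : exists G : R -> R, forall t, 0 <= t -> derivable G t 1 /\ G^`()%classic t = g t.
  exists (fun t => (\int[lebesgue_measure]_(s in `[-1, t]) g s)%R) => t t0.
  apply: (@continuous_FTC1_closed R g (-1) t (t + 1)); first 3 last.
  - exact: cg.
  - by rewrite ltrDl.
  - apply: continuous_compact_integrable; first exact: segment_compact.
    exact: continuous_subspaceT.
  - by apply: lt_le_trans t0; rewrite ltrN10.
exists (fun t => G t - G 0); split => [|t t0]; first by rewrite subrr.
have [dG GE] := GP t t0.
split; first exact: derivableB.
rewrite deriveB// derive_cst subr0 -derive1E.
exact: GE.
Qed.

(** The primitive that vanishes at 0 is frozen for [t <= 0], which keeps it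
    continuous on the line and leaves right derivatives at [t >= 0] unchanged. *)
Lemma antiderivative (R : realType) (n : nat) (g : R -> 'cV[R]_n) : continuous g ->
  exists F : R -> 'cV[R]_n, [/\ continuous F, forall t, t <= 0 -> F t = 0,
    forall t, 0 <= t -> right_derivative_at F t (g t) &
    forall t : R, 0 < t -> is_derive t (1 : R) F (g t)].
Proof.
move=> cg.
have cgi i : continuous (fun t => g t i ord0).
  move=> t; apply/continuous_distP => e e0.
  have [r r0 gr] := (continuous_distP _ _).1 (cg t) _ e0.
  exists r => // s /gr; apply: le_trans.
  by have := normv_entry (g s - g t) i; rewrite !mxE.
have /choice[F FP] := fun i => antiderivative_real (cgi i).
pose G t := \col_i F i t.
have G0 : G 0 = 0 by apply/matrixP => i j; rewrite !mxE (FP i).1.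
have dG (t : R) : 0 <= t -> is_derive t (1 : R) G (g t).
  move=> t0.
  have dF : derivable G t 1.
    apply/derivable_mxP => i j.
    rewrite (_ : (fun x => _) = F i); first exact: ((FP i).2 t t0).1.
    by apply/funext => s; rewrite mxE.
  split => //; rewrite derive_mx//; apply/matrixP => i j; rewrite !mxE (ord1 j).
  rewrite (_ : (fun x => _) = F i); first exact: ((FP i).2 t t0).2.
  by apply/funext => s; rewrite mxE.
exists (fun t => G (Num.max 0 t)); split.
- move=> t; have cG : {for Num.max 0 t, continuous G}.
    apply/differentiable_continuous/derivable1_diffP.
    by have [|] := dG (Num.max 0 t) _; rewrite ?le_max ?lexx.
  exact: (continuous_comp (continuous_maxl (c := 0) (x := t)) cG).
- by move=> t t0; rewrite (max_idPl t0).
- move=> t t0 e e0; have [r r0 rG] := is_derive_right (dG t t0) e0.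
  exists r => // h hr; rewrite (max_idPr t0) max_r; first exact: rG.
  by case/andP: hr => /ltW h0 _; exact: addr_ge0.
- move=> t t0; apply: (near_eq_is_derive _ (dG t (ltW t0))).
  near=> s; rewrite max_r//; apply: ltW; near: s; exact: lt_nbhsr.
Unshelve. all: by end_near. Qed.

Lemma continuous_bigsum (R : realType) (V : normedModType R) (I : Type)
    (r : seq I) (F : I -> R -> V) :
  (forall i, continuous (F i)) -> continuous (fun t => \sum_(i <- r) F i t).
Proof.
move=> cF; elim: r => [|i r IH].
  by under eq_fun do rewrite big_nil; move=> t; exact: cvg_cst.
under eq_fun do rewrite big_cons.
by move=> t; apply: cvgD; [exact: cF|exact: IH].
Qed.

(** * The difference operator *)

(** With this notation [D x_t = x t - delay_sum A delta x t]. *)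
Definition delay_sum (R : realType) (n p : nat) (A : 'I_p -> 'M[R]_n)
    (delta : 'I_p -> R) (y : R -> 'cV[R]_n) (t : R) : 'cV[R]_n :=
  \sum_(j < p) A j *m y (t - delta j).

Lemma delay_sumB (R : realType) (n p : nat) (A : 'I_p -> 'M[R]_n) delta y1 y2 t :
  delay_sum A delta (y1 \- y2) t = delay_sum A delta y1 t - delay_sum A delta y2 t.
Proof.
by rewrite /delay_sum -sumrB; apply: eq_bigr => j _; rewrite mulmxBr.
Qed.

Lemma continuous_delay_sum (R : realType) (n p : nat) (A : 'I_p -> 'M[R]_n) delta
    (y : R -> 'cV[R]_n) : continuous y -> continuous (delay_sum A delta y).
Proof.
move=> cy; apply: continuous_bigsum => j; apply: continuous_mulmx => t.
apply: (@continuous_comp _ _ _ (fun t => t - delta j) y); last exact: cy.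
by apply: cvgB; [exact: cvg_id|exact: cvg_cst].
Qed.

Lemma Dop_segment (R : realType) (n p : nat) (A : 'I_p -> 'M[R]_n) delta x t :
  Dop A delta (segment_at x t) = x t - delay_sum A delta x t.
Proof. by rewrite /Dop /segment_at addr0. Qed.

(** The weight beats both constants because [expR (g * dm) >= 1 + g * dm] grows
    at least linearly in [g]. *)
Lemma weight_rate (R : realType) (a dm L : R) : 0 <= a -> 0 < dm -> 0 <= L ->
  exists g : R, [/\ 0 < g, a * expR (- (g * dm)) <= 4^-1 & L / g <= 4^-1].
Proof.
move=> a0 dm0 L0.
have adm : 0 <= a / dm by rewrite divr_ge0// ltW.
pose g := 4 * (a / dm + L) + 1.
have g0 : 0 < g by rewrite /g; lra.
have E0 := expR_gt0 (g * dm).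
exists g; split => //.
  rewrite expRN ler_pdivrMr//.
  have gdm : g * dm = 4 * a + (4 * L + 1) * dm.
    by rewrite /g; field; rewrite gt_eqF.
  by have := expR_ge1Dx (g * dm); rewrite {1}gdm; nra.
by rewrite ler_pdivrMr//; rewrite /g; lra.
Qed.

Section neutral_system.
Context (R : realType) (n p : nat) (Delta dm : R) (delta : 'I_p -> R)
  (A : 'I_p -> 'M[R]_n) (a g : R).
(** [dm] bounds the delays from below, [a] bounds the difference operator, and at
    the weight [g] this operator gains a factor 1/4. *)
Context (dm0 : 0 < dm) (dmD : forall j, dm <= delta j <= Delta) (a0 : 0 <= a)
  (aP : forall (w : 'I_p -> 'cV[R]_n) (m : R),
    (forall j, `|w j| <= m) -> 0 <= m -> `|\sum_(j < p) A j *m w j| <= a * m)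
  (g0 : 0 < g) (ag : a * expR (- (g * dm)) <= 4^-1).

Local Notation S := (delay_sum A delta).

Lemma delay_sum_le (z : R -> 'cV[R]_n) (m t : R) : 0 <= m ->
  (forall s, t - Delta <= s <= t - dm -> `|z s| <= m) -> `|S z t| <= a * m.
Proof.
move=> m0 zm; apply: aP => // j; apply: zm.
by have /andP[d1 d2] := dmD j; apply/andP; split; lra.
Qed.

Lemma delay_sum_eq (y1 y2 : R -> 'cV[R]_n) (t : R) :
  (forall s, t - Delta <= s <= t - dm -> y1 s = y2 s) -> S y1 t = S y2 t.
Proof.
move=> yE; apply: eq_bigr => j _; rewrite yE//.
by have /andP[d1 d2] := dmD j; apply/andP; split; lra.
Qed.

(** The delays are at least [dm], so a bound [C * expR (g * s)] is used at times
    [s <= t - dm] and gains [expR (- (g * dm))].  The histories contribute [a * m]. *)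
Lemma delay_sum_weighted (z : R -> 'cV[R]_n) (m C t : R) : 0 <= m -> 0 <= C -> 0 <= t ->
  (forall s, - Delta <= s <= 0 -> `|z s| <= m) ->
  (forall s, 0 <= s -> `|z s| <= C * expR (g * s)) ->
  `|S z t| <= a * m + 4^-1 * C * expR (g * t).
Proof.
move=> m0 C0 t0 zm zC.
have E0 := expR_gt0 (g * t).
have D0 : 0 <= C * expR (g * (t - dm)) by rewrite mulr_ge0// expR_ge0.
apply: (@le_trans _ _ (a * (m + C * expR (g * (t - dm))))).
  apply: delay_sum_le => [|s /andP[s1 s2]]; first exact: addr_ge0.
  have [s0|/ltW s0] := leP s 0.
    by rewrite -[leLHS]addr0 lerD// zm//; apply/andP; split; lra.
  rewrite -[leLHS]add0r lerD// (le_trans (zC _ s0))// ler_wpM2l//.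
  by rewrite ler_expR ler_wpM2l// ltW.
have EE : expR (g * (t - dm)) = expR (g * t) * expR (- (g * dm)).
  by rewrite -expRD; congr expR; ring.
have CE : 0 <= C * expR (g * t) by rewrite mulr_ge0// ltW.
rewrite mulrDr lerD2l EE.
have -> : a * (C * (expR (g * t) * expR (- (g * dm)))) =
  a * expR (- (g * dm)) * (C * expR (g * t)) by ring.
by rewrite -[leRHS]mulrA ler_wpM2r.
Qed.

(** Fixed point of [y |-> delay_sum y + w] in the weighted norm, started at 0. *)
Lemma forced_delay_exists (w : R -> 'cV[R]_n) U :
  continuous w -> (forall t : R, t <= 0 -> w t = 0) -> 0 <= U ->
  (forall t : R, 0 <= t -> `|w t| <= U) ->
  exists y : R -> 'cV[R]_n, [/\ continuous y, forall t : R, t <= 0 -> y t = 0,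
    forall t : R, y t = S y t + w t &
    forall t : R, 0 <= t -> `|y t| <= 2 * U * expR (g * t)].
Proof.
move=> cw w0 U0 wU.
have Delta0 : forall j : 'I_p, 0 <= delta j.
  by move=> j; have /andP[d1 _] := dmD j; apply: le_trans d1; exact: ltW.
have S0 y t : (forall s, s <= 0 -> y s = 0) -> t <= 0 -> S y t = 0.
  move=> y0 t0; apply: big1 => j _; rewrite y0 ?mulmx0//.
  by rewrite subr_le0 (le_trans t0).
have [||||||||y [cy y0 yE yU]] := @weighted_contraction R 'cV[R]_n g 4^-1 U (fun=> 0)
  (fun y t => S y t + w t).
- exact: ltW.
- by apply/andP; split; lra.
- by [].
- by move=> t; exact: cvg_cst.
- move=> y cy t; apply: cvgD; [exact: continuous_delay_sum|exact: cw].
- by move=> y _ y0 t t0; rewrite S0// w0// addr0.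
- move=> y1 y2 C c1 c2 y12 C0 yC t t0.
  rewrite opprD addrACA subrr addr0 -delay_sumB.
  rewrite -[leRHS]add0r -[X in X + _](mulr0 a); apply: delay_sum_weighted => // s.
  by move=> /andP[_ s0]; rewrite /= y12// subrr normr0.
- move=> t t0; rewrite subr0.
  rewrite (_ : S _ t = 0); last by rewrite /delay_sum big1// => j _; rewrite mulmx0.
  rewrite add0r; apply: le_trans (wU t t0) _; rewrite ler_peMr//.
  by rewrite -expR0 ler_expR mulr_ge0// ltW.
- exists y; split => // t t0; have := yU t t0; rewrite subr0 => /le_trans; apply.
  by rewrite ler_wpM2r ?expR_ge0// ler_pdivrMr; lra.
Qed.

(** * Asymptotically stable difference equations with forcing *)

Lemma max_delay_le : 0 <= Delta -> max_delay delta <= Delta.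
Proof.
by move=> D0; apply: bigmax_le => // j _; have /andP[] := dmD j.
Qed.

Lemma max_delay_ge0 : 0 <= max_delay delta.
Proof. by apply: bigmax_ge_id. Qed.

(** Asymptotic stability speaks of histories below a threshold [b].  The
    homogeneous equation is linear, so a history of any size [m] can be scaled
    below [b] first; this turns the smallness statement into a linear bound. *)
Lemma difference_decay_scaled (b eps T : R) : 0 <= Delta -> 0 < b -> 0 < eps ->
  (forall sigma y, difference_solution A delta sigma y ->
     supnorm (max_delay delta) (segment_at y sigma) < b ->
     forall t, sigma + T <= t ->
       supnorm (max_delay delta) (segment_at y t) < eps) ->
  forall sigma (y : R -> 'cV[R]_n) m, continuous y ->
    (forall t, sigma <= t -> y t = S y t) ->
    0 <= m -> (forall s, sigma - Delta <= s <= sigma -> `|y s| <= m) ->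
    forall t, sigma + T <= t -> `|y t| <= eps * 2 * n.+1%:R / b * m.
Proof.
move=> D0 b0 eps0 uas sigma y m cy yE.
wlog m0 : m / 0 < m => [hm m0 ym t st|].
  set c := eps * 2 * _ / b; have c0 : 0 <= c.
    by rewrite divr_ge0 ?(ltW b0)// !mulr_ge0// ltW.
  apply/ler_addgt0Pr => e e0.
  have em : 0 < m + e / (c + 1) by rewrite ltr_wpDl// divr_gt0// ltr_wpDl.
  apply: le_trans (hm _ em (ltW em) _ t st) _.
    by move=> s /ym /le_trans; apply; rewrite lerDl divr_ge0 ?ltW// ltr_wpDl.
  rewrite -/c mulrDr lerD2l mulrA ler_pdivrMr ?ltr_wpDl//.
  by rewrite mulrC ler_wpM2l ?(ltW e0)// lerDl.
move=> _ ym t st.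
(* [n.+1] instead of [n] keeps the scaled norm strictly below [b], also for [n = 0] *)
pose c := b / (2 * n.+1%:R * m).
have N0 : 0 < n.+1%:R :> R by rewrite ltr0n.
have c0 : 0 < c by rewrite divr_gt0// !mulr_gt0.
have cy' : continuous (fun s => c *: y s).
  by move=> s; apply: cvgZl_tmp; exact: cy.
have sol : difference_solution A delta sigma (fun s => c *: y s).
  split; first exact: continuous_subspaceT.
  move=> s ss; rewrite yE// /delay_sum scaler_sumr; apply: eq_bigr => j _.
  by rewrite -scalemxAr.
have small : supnorm (max_delay delta) (segment_at (fun s => c *: y s) sigma) < b.
  apply: le_lt_trans (supnorm_le max_delay_ge0 (m := c * m) _) _.
    move=> s /andP[s1 s2]; rewrite /segment_at normrZ gtr0_norm// ler_wpM2l ?(ltW c0)//.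
    by apply: ym; have := max_delay_le D0; lra.
  have -> : n%:R * (c * m) = b * (n%:R / (2 * n.+1%:R)).
    by rewrite /c; field; rewrite !gt_eqF.
  rewrite gtr_pMr// ltr_pdivrMr ?mulr_gt0// mul1r -natrM ltr_nat.
  by rewrite mul2n -addnn ltn_addr.
have := uas _ _ sol small t st.
have c3 := @Cspace_segment_at _ n (max_delay delta) _ t cy'.
have := @normv_le_supnorm _ _ _ max_delay_ge0 _ 0 c3.
rewrite lexx oppr_le0 max_delay_ge0 => /(_ isT) h1 h2.
have := le_lt_trans h1 h2.
rewrite /segment_at addr0 normrZ gtr0_norm// /c => h3.
apply: ltW; rewrite (_ : eps * 2 * _ / b * m = eps / (b / (2 * n.+1%:R * m))); last first.
  by field; rewrite !gt_eqF.
by rewrite ltr_pdivlMr// mulrC.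
Qed.

(** Stability, that is, no waiting time. *)
Lemma difference_bounded : 0 <= Delta -> difference_UAS A delta ->
  exists2 K : R, 0 <= K & forall sigma (y : R -> 'cV[R]_n) m, continuous y ->
    (forall t, sigma <= t -> y t = S y t) ->
    0 <= m -> (forall s, sigma - Delta <= s <= sigma -> `|y s| <= m) ->
    forall t, sigma <= t -> `|y t| <= K * m.
Proof.
move=> D0 [/(_ 1 ltr01)[b b0 uas] _].
exists (1 * 2 * n.+1%:R / b); first by rewrite divr_ge0 ?ltW// !mulr_gt0.
move=> sigma y m cy yE m0 ym t st.
apply: (@difference_decay_scaled b 1 0 D0 b0 ltr01 _ sigma) => // [s z sol zb u|].
  by rewrite addr0; exact: uas sol zb u.
by rewrite addr0.
Qed.

(** Attraction: after a time that depends on [kappa], any ratio is reached. *)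
Lemma difference_attractive (kappa : R) : 0 <= Delta -> difference_UAS A delta ->
  0 < kappa ->
  exists2 T : R, 0 < T & forall sigma (y : R -> 'cV[R]_n) m, continuous y ->
    (forall t, sigma <= t -> y t = S y t) ->
    0 <= m -> (forall s, sigma - Delta <= s <= sigma -> `|y s| <= m) ->
    forall t, sigma + T <= t -> `|y t| <= kappa * m.
Proof.
move=> D0 [_ [b b0 uas]] k0.
have N0 : 0 < n.+1%:R :> R by rewrite ltr0n.
have e0 : 0 < kappa * b / (2 * n.+1%:R) by rewrite !(mulr_gt0, divr_gt0).
have [T T0 uasT] := uas _ e0.
exists T => // sigma y m cy yE m0 ym t st.
rewrite (_ : kappa = kappa * b / (2 * n.+1%:R) * 2 * n.+1%:R / b); last first.
  by field; rewrite !gt_eqF.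
exact: (difference_decay_scaled D0 b0 e0 uasT cy yE).
Qed.

(** The forced solution [y] is not comparable with homogeneous ones directly,
    because its history does not satisfy the compatibility condition at time 0.
    Subtracting the response [v] to the forcing [rho * u], where the ramp [rho]
    grows from 0 to 1 during [[0, dm]], leaves a continuous [z] which solves the
    homogeneous equation from time [dm] on.  There [z] is attracted to 0, while [v]
    is bounded by the size of [u]. *)
Lemma forced_window : 0 < Delta -> difference_UAS A delta ->
  exists T C : R, [/\ Delta <= T, 0 <= C & forall (y u : R -> 'cV[R]_n) m U,
    continuous y -> continuous u -> 0 <= m -> 0 <= U ->
    (forall t, 0 <= t -> y t = S y t + u t) ->
    (forall t, 0 <= t -> `|u t| <= U) ->
    (forall s, - Delta <= s <= 0 -> `|y s| <= m) ->
    (forall t, 0 <= t <= T -> `|y t| <= C * (m + U)) /\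
    (forall t, T - Delta <= t <= T -> `|y t| <= 2^-1 * m + C * U)].
Proof.
move=> D0 uas; have a0' := a0; have dm0' := dm0.
have [K K0 KP] := difference_bounded (ltW D0) uas.
pose k := (2 * (1 + a))^-1.
have k0 : 0 < k by rewrite invr_gt0 mulr_gt0// ltr_wpDr.
have [T1 T10 TP] := difference_attractive (ltW D0) uas k0.
pose T := dm + T1 + Delta.
pose E := expR (g * T).
have E0 : 0 < E by exact: expR_gt0.
pose C := (1 + a) + K * (1 + a) + 1 + 2 * E.
have Ka : 0 <= K * (1 + a) by rewrite mulr_ge0// addr_ge0.
exists T, C; split; [rewrite /T; lra|rewrite /C; lra|].
move=> y u m U cy cu m0 U0 yE uU ym.
pose rho t : R := Num.max 0 (Num.min (t / dm) 1).
have rho0 t : t <= 0 -> rho t = 0.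
  move=> t0; rewrite /rho; apply/max_idPl; rewrite ge_min; apply/orP; left.
  by rewrite pmulr_lle0 ?invr_gt0.
have rho1 t : dm <= t -> rho t = 1.
  move=> t0; rewrite /rho (min_idPr _) ?(max_idPr _)//.
  by rewrite ler_pdivlMr// mul1r.
have rho01 t : 0 <= rho t <= 1.
  by rewrite /rho le_max lexx/= ge_max ler01 ge_min lexx orbT.
have crho : continuous rho.
  move=> t.
  have c1 : {for t, continuous (fun t : R => t / dm)} by exact: mulrr_continuous.
  have c2 := continuous_comp c1 (continuous_minr (c := 1) (x := t / dm)).
  exact: (continuous_comp c2 (continuous_maxl (c := 0) (x := Num.min (t / dm) 1))).
pose w t := rho t *: u t.
have cw : continuous w.
  by move=> t; apply: cvgZ; [exact: crho|exact: cu].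
have [||||v [cv v0 vE vU]] := forced_delay_exists (w := w) (U := U).
- by [].
- by move=> t t0; rewrite /w rho0// scale0r.
- by [].
- move=> t t0; rewrite /w normrZ; have /andP[r0 r1] := rho01 t.
  rewrite ger0_norm//; apply: le_trans (uU t t0).
  by rewrite ler_piMl.
have vT t : 0 <= t <= T -> `|v t| <= 2 * E * U.
  move=> /andP[t0 tT]; apply: le_trans (vU t t0) _.
  rewrite mulrAC ler_wpM2r// ler_wpM2l// ler_expR ler_wpM2l//.
  exact: ltW.
pose z := y \- v.
have cz : continuous z by move=> t; apply: cvgB; [exact: cy|exact: cv].
have zE t : 0 <= t -> z t = S z t + (1 - rho t) *: u t.
  move=> t0; rewrite delay_sumB /z/= yE// {1}vE /w scalerBl scale1r.
  by rewrite opprD addrACA.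
have zn s : - Delta <= s <= 0 -> `|z s| <= m.
  by move=> /[dup] /ym ys /andP[_ s0]; rewrite /z/= v0// subr0.
pose m' := (1 + a) * m + U.
have am : 0 <= a * m by rewrite mulr_ge0.
have m'0 : 0 <= m' by rewrite /m'; nra.
have zm s : - Delta <= s <= dm -> `|z s| <= m'.
  move=> /andP[s1 s2]; have [s0|/ltW s0] := leP s 0.
    apply: le_trans (zn s _) _; first by apply/andP; split=> //; lra.
    by rewrite /m'; nra.
  rewrite zE//; apply: le_trans (ler_normD _ _) _.
  have : `|S z s| <= a * m.
    apply: delay_sum_le => // r /andP[r1 r2]; apply: zn; apply/andP; split; lra.
  have : `|(1 - rho s) *: u s| <= U.
    have /andP[r0 r1] := rho01 s.
    rewrite normrZ ger0_norm ?subr_ge0//; apply: le_trans (uU s s0).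
    by rewrite ler_piMl// lerBlDr lerDl.
  by rewrite /m'; lra.
have zm' s : dm - Delta <= s <= dm -> `|z s| <= m'.
  by move=> /andP[s1 s2]; apply: zm; apply/andP; split; lra.
have zH t : dm <= t -> z t = S z t.
  move=> t0; rewrite zE ?rho1 ?subrr ?scale0r ?addr0//.
  by apply: le_trans t0; exact: ltW.
have yz t : `|y t| <= `|z t| + `|v t|.
  by rewrite -{1}(subrK (v t) (y t)); exact: ler_normD.
have EU : 0 <= E * U by rewrite mulr_ge0// ltW.
have KaU : 0 <= K * (1 + a) * U by rewrite mulr_ge0.
have Kam : 0 <= K * (1 + a) * m by rewrite mulr_ge0.
have KaU' : 0 <= K * a * U by rewrite !mulr_ge0.
have Em : 0 <= E * m by rewrite mulr_ge0// ltW.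
have aU : 0 <= a * U by rewrite mulr_ge0.
split=> t /andP[t1 t2].
  have zt : `|z t| <= m' + K * m'.
    have Km' : 0 <= K * m' by rewrite mulr_ge0.
    have [td|/ltW td] := leP t dm.
      have := zm t ltac:(apply/andP; split; lra); lra.
    have := KP dm z m' cz zH m'0 zm' t td; lra.
  have := yz t; have := vT t ltac:(apply/andP; split; lra).
  by move: zt; rewrite /C /m'; lra.
have zt : `|z t| <= k * m'.
  by apply: (TP dm z m' cz zH m'0 zm' t); move: t1; rewrite /T; lra.
have km : k * m' <= 2^-1 * m + U.
  have -> : k * m' = 2^-1 * m + k * U.
    by rewrite /k /m'; field; rewrite gt_eqF//; lra.
  rewrite lerD2l ler_piMl// /k invf_le1//; lra.
have := yz t; have t0 : 0 <= t by move: t1; rewrite /T; lra.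
have := vT t ltac:(apply/andP; split; lra).
move: km zt; rewrite /C; lra.
Qed.

(** The window estimate is iterated at times [k * T].  The rate is chosen such
    that one window costs at most the factor [3 / 4]: then half of the old bound
    plus the forcing stays below the new bound as soon as [N >= 4 * C]. *)
Lemma forced_decay (mu : R) : 0 < Delta -> difference_UAS A delta -> 0 < mu ->
  exists M lambda : R, [/\ 0 < M, 0 < lambda &
    forall (y u : R -> 'cV[R]_n) m, continuous y -> continuous u -> 0 <= m ->
    (forall t, 0 <= t -> y t = S y t + u t) ->
    (forall t, 0 <= t -> `|u t| <= m * expR (- (mu * t))) ->
    (forall s, - Delta <= s <= 0 -> `|y s| <= m) ->
    forall t, 0 <= t -> `|y t| <= M * expR (- (lambda * t)) * m].
Proof.
move=> D0 uas mu0.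
have [T [C [TD C0 win]]] := forced_window D0 uas.
have T0 : 0 < T by apply: lt_le_trans TD.
pose lambda := Num.min mu (4 * T)^-1.
have l0 : 0 < lambda by rewrite lt_min mu0 invr_gt0 mulr_gt0.
have lmu : lambda <= mu by rewrite ge_min lexx.
have lT : lambda * T <= 4^-1.
  apply: (@le_trans _ _ ((4 * T)^-1 * T)).
    by rewrite ler_wpM2r ?(ltW T0)// ge_min lexx orbT.
  by rewrite invfM mulfVK ?gt_eqF.
pose N := 1 + 4 * C.
have N0 : 0 < N by rewrite /N; lra.
exists (C * (N + 1) * expR (lambda * T) + 1), lambda; split=> //.
  by rewrite ltr_wpDl// mulr_ge0 ?expR_ge0// mulr_ge0//; lra.
move=> y u m cy cu m0 yE um ym t t0.
(* the bound of the forcing on the [k]-th window is at most [q k] *)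
pose q k := expR (- (lambda * (k%:R * T))) * m.
have q0 k : 0 <= q k by rewrite mulr_ge0 ?expR_ge0.
have qS k : 3 / 4 * q k <= q k.+1.
  rewrite /q -[k.+1%:R]natr1.
  have -> : - (lambda * ((k%:R + 1) * T)) = - (lambda * (k%:R * T)) + - (lambda * T) by ring.
  rewrite expRD [leRHS]mulrAC [leRHS]mulrC ler_wpM2r//; first exact: q0.
  by have := expR_ge1Dx (- (lambda * T)); lra.
have shift k : (forall s, k%:R * T - Delta <= s <= k%:R * T -> `|y s| <= N * q k) ->
    (forall s, 0 <= s <= T -> `|y (k%:R * T + s)| <= C * (N * q k + q k)) /\
    (forall s, T - Delta <= s <= T -> `|y (k%:R * T + s)| <= 2^-1 * (N * q k) + C * q k).
  move=> yk; pose tk := k%:R * T.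
  have tk0 : 0 <= tk by rewrite mulr_ge0// ltW.
  apply: (win (segment_at y tk) (segment_at u tk));
    [exact: continuous_segment_at|exact: continuous_segment_at| | | | |].
  - by rewrite mulr_ge0// ltW.
  - exact: q0.
  - move=> s s0; rewrite {1}/segment_at yE ?addr_ge0//; congr (_ + _).
    by apply: eq_bigr => j _; rewrite /segment_at addrA.
  - move=> s s0; apply: le_trans (um _ (addr_ge0 tk0 s0)) _.
    rewrite mulrC ler_wpM2r// ler_expR lerN2 mulrDr.
    have : lambda * tk <= mu * tk by rewrite ler_wpM2r.
    have : 0 <= mu * s by rewrite mulr_ge0// ltW.
    by rewrite /tk; lra.
  - by move=> s /andP[s1 s2]; apply: yk; rewrite -/tk; apply/andP; split; lra.
have yk k : forall s, k%:R * T - Delta <= s <= k%:R * T -> `|y s| <= N * q k.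
  elim: k => [|k IH] s.
    rewrite mul0r sub0r => /ym ys; apply: le_trans ys _.
    by rewrite /q mul0r mulr0 oppr0 expR0 mul1r ler_peMl// /N; lra.
  move=> /andP[s1 s2].
  have := (shift k IH).2 (s - k%:R * T).
  rewrite [_ * T + (_ - _)]addrC subrK; move: s1 s2.
  rewrite -[k.+1%:R]natr1 mulrDl mul1r => s1 s2 h.
  have {}h := h ltac:(apply/andP; split; lra).
  apply: le_trans h _; have := qS k; have := q0 k; rewrite /N.
  have : 0 <= C * q k by rewrite mulr_ge0.
  have : C * (3 / 4 * q k) <= C * q k.+1 by rewrite ler_wpM2l.
  lra.
have [k /andP[k1 k2]] : exists k : nat, k%:R * T <= t <= k%:R * T + T.
  exists (Num.truncn (t / T)).
  have /andP[h1 h2] := truncn_itv (divr_ge0 t0 (ltW T0)).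
  rewrite ler_pdivlMr// in h1; rewrite ltr_pdivrMr// -natr1 mulrDl mul1r in h2.
  by rewrite h1 ltW.
have := (shift k (yk k)).1 (t - k%:R * T).
rewrite [_ * T + (_ - _)]addrC subrK => h; have {}h := h ltac:(apply/andP; split; lra).
apply: le_trans h _.
have -> : C * (N * q k + q k) = C * (N + 1) * q k by ring.
have qk : q k <= expR (lambda * T) * expR (- (lambda * t)) * m.
  rewrite /q ler_wpM2r// -expRD ler_expR.
  have : lambda * t <= lambda * (k%:R * T + T) by rewrite ler_wpM2l// ltW.
  by rewrite mulrDr; lra.
apply: (@le_trans _ _ (C * (N + 1) * (expR (lambda * T) * expR (- (lambda * t)) * m))).
  by rewrite ler_wpM2l// mulr_ge0//; lra.
have : 0 <= expR (- (lambda * t)) * m by rewrite mulr_ge0 ?expR_ge0.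
lra.
Qed.

(** * The neutral equation: existence and continuous dependence *)

Context (f : (R -> 'cV[R]_n) -> 'cV[R]_n) (L : R) (Delta0 : 0 < Delta) (L0 : 0 <= L)
  (fL : sup_lipschitz Delta L f)
  (f0 : f (fun=> 0) = 0) (Lg : L / g <= 4^-1).

(** Solutions in the form used by the estimates: defined and continuous on the
    whole line, with the values before [- Delta] immaterial. *)
Definition extended_solution (x : R -> 'cV[R]_n) : Prop :=
  continuous x /\ forall t : R, 0 <= t ->
    right_derivative_at (fun s => x s - S x s) t (f (segment_at x t)).

Let continuous_f_segment (x : R -> 'cV[R]_n) : continuous x ->
  continuous (fun t => f (segment_at x t)).
Proof. exact: continuous_lipschitz_segment fL. Qed.

Lemma f_segment_le (x : R -> 'cV[R]_n) m t : continuous x ->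
  (forall s, t - Delta <= s <= t -> `|x s| <= m) -> `|f (segment_at x t)| <= L * m.
Proof.
move=> cx xm; rewrite -[f _]subr0 -f0; apply: fL.
- exact: Cspace_segment_at.
- by apply: (@Cspace_eq _ _ _ _ (fun=> 0)) => [s|//]; exact: cvg_cst.
- move=> s /andP[s1 s2]; rewrite subr0; apply: xm.
  by apply/andP; split; lra.
Qed.

(** Fixed point of the integrated equation
    [y t = y0 t + delay_sum y t - delay_sum y 0 + int_0^t f y_s ds], in which [t] is
    replaced by [max 0 t] in all terms but the first.  So the operator leaves the
    history [y0] alone and maps continuous functions to continuous functions. *)
Lemma neutral_solution_exists (phi : R -> 'cV[R]_n) : Cspace n Delta phi ->
  exists x, neutral_solution Delta delta A f phi x.
Proof.
move=> /(Cspace_extend (ltW Delta0))[y0 [cy0 y0phi y0l y0r]].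
have cphi : Cspace n Delta phi by apply: (Cspace_eq cy0) => s /y0phi.
have [m m0 phim] := Cspace_bounded (ltW Delta0) cphi.
have y0m s : `|y0 s| <= m.
  have D0 := Delta0.
  have [sD|/ltW sD] := leP s (- Delta).
    by rewrite y0l//; apply: phim; apply/andP; split; lra.
  have [s0|/ltW s0] := leP s 0.
    by rewrite y0phi ?phim// sD.
  by rewrite y0r//; apply: phim; apply/andP; split; lra.
have /choice[F FP] : forall y : R -> 'cV[R]_n, exists F : R -> 'cV[R]_n,
    continuous y -> [/\ continuous F, forall t, t <= 0 -> F t = 0,
    forall t, 0 <= t -> right_derivative_at F t (f (segment_at y t)) &
    forall t : R, 0 < t -> is_derive t (1 : R) F (f (segment_at y t))].
  move=> y; have [cy|ncy] := pselect (continuous y); last by exists (fun=> 0).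
  by have [F FP] := antiderivative (continuous_f_segment cy); exists F.
pose T y t := y0 t + (S y (Num.max 0 t) - S y 0) + F y t.
have C00 : 0 <= 2 * a * m + L * m / g.
  by apply: addr_ge0; rewrite ?divr_ge0 ?mulr_ge0// ltW.
have D0 := Delta0; have g0' := g0.
have [|||||||x [cx x0 xE _]] := @weighted_contraction R 'cV[R]_n g 2^-1 _ y0 T _ _ C00.
- exact: ltW.
- by apply/andP; split; lra.
- exact: cy0.
- move=> y cy; have [cF _ _ _] := FP y cy; move=> t.
  apply: cvgD; last exact: cF.
  apply: cvgD; first exact: cy0.
  apply: cvgB; last exact: cvg_cst.
  exact: (continuous_comp (continuous_maxl (c := 0) (x := t))
    (continuous_delay_sum (A := A) (delta := delta) cy (x := Num.max 0 t))).
- move=> y cy _ t t0; have [_ F0 _ _] := FP y cy.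
  by rewrite /T (max_idPl t0) subrr addr0 F0// addr0.
- move=> y1 y2 C c1 c2 y12 C0 yC t t0.
  have [cF1 F10 dF1 _] := FP y1 c1; have [cF2 F20 dF2 _] := FP y2 c2.
  have zn s : s <= 0 -> `|(y1 \- y2) s| <= 0.
    by move=> s0; rewrite /= y12// subrr normr0.
  have S0 : S y1 0 = S y2 0.
    apply: delay_sum_eq => s /andP[_ s2]; apply: y12.
    by have := dm0; lra.
  have -> : T y1 t - T y2 t = S (y1 \- y2) t + (F y1 t - F y2 t).
    rewrite /T (max_idPr t0) delay_sumB S0.
    rewrite opprD addrACA; congr (_ + _).
    by rewrite opprD addrACA subrr add0r opprD addrACA subrr addr0.
  apply: le_trans (ler_normD _ _) _.
  have h1 : `|S (y1 \- y2) t| <= a * 0 + 4^-1 * C * expR (g * t).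
    by apply: delay_sum_weighted => // s /andP[_ s0]; exact: zn.
  have h2 : `|(F y1 \- F y2) t - (F y1 \- F y2) 0| <= L * C / g * expR (g * t).
    apply: (expR_mean_value g0 _ (d := fun t => f (segment_at y1 t) - f (segment_at y2 t))) => //.
    - by rewrite mulr_ge0.
    - by move=> s; apply: cvgB; [exact: cF1|exact: cF2].
    - by move=> s s0; apply: right_derivativeB; [exact: dF1|exact: dF2].
    - move=> s s0; rewrite -mulrA; apply: fL; try exact: Cspace_segment_at.
      move=> r /andP[_ r0]; rewrite /segment_at.
      have [sr|/ltW sr] := leP (s + r) 0.
        by apply: le_trans (zn _ sr) _; rewrite mulr_ge0// expR_ge0.
      apply: le_trans (yC _ sr) _; rewrite ler_wpM2l// ler_expR ler_wpM2l//.
        exact: ltW.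
      by lra.
  move: h2; rewrite /= (F10 0)// (F20 0)// !subr0 => h2.
  have : L * C / g * expR (g * t) <= 4^-1 * (C * expR (g * t)).
    have -> : L * C / g * expR (g * t) = L / g * (C * expR (g * t)) by ring.
    rewrite ler_wpM2r//.
    by rewrite mulr_ge0// expR_ge0.
  lra.
- move=> t t0; have [cF F00 dF _] := FP y0 cy0.
  have E1 : 1 <= expR (g * t) by rewrite -expR0 ler_expR mulr_ge0// ltW.
  have -> : T y0 t - y0 t = S y0 t - S y0 0 + F y0 t.
    by rewrite /T (max_idPr t0) addrAC [y0 t + _]addrC addrK.
  have h1 s : `|S y0 s| <= a * m by apply: delay_sum_le.
  have h2 : `|F y0 t - F y0 0| <= L * m / g * expR (g * t).
    apply: (expR_mean_value g0 _ (d := fun t => f (segment_at y0 t))) => //.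
    - by rewrite mulr_ge0.
    - move=> s s0; apply: (@le_trans _ _ (L * m)); first exact: f_segment_le.
      by rewrite ler_peMr ?mulr_ge0// -expR0 ler_expR mulr_ge0// ltW.
  move: h2; rewrite (F00 0)// subr0 => h2.
  apply: le_trans (ler_normD _ _) _; rewrite mulrDl; apply: lerD => //.
  apply: le_trans (ler_normB _ _) _.
  have := h1 t; have := h1 0.
  have : a * m <= a * m * expR (g * t) by rewrite ler_peMr// mulr_ge0.
  lra.
have [cF F00 dF dF'] := FP x cx.
have xD t : 0 <= t -> Dop A delta (segment_at x t) = x 0 - S x 0 + F x t.
  move=> t0; rewrite Dop_segment -{1}xE /T (max_idPr t0) y0r// x0// y0phi ?lexx ?oppr_le0 ?ltW//.
  by rewrite addrA addrAC (addrAC _ (S x t)) addrK.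
exists x; split.
- exact: continuous_subspaceT.
- by move=> s; rewrite in_itv/= => /andP[s1 s2]; rewrite x0// y0phi// s1.
- move=> t t0; apply: (near_eq_is_derive (f := fun s => x 0 - S x 0 + F x s)).
    near=> s; rewrite xD//; apply: ltW; near: s; exact: lt_nbhsr.
  have dFt := dF' t t0.
  by apply: is_derive_eq; rewrite add0r.
- apply/right_derivative_cvg => e e0.
  have [r r0 Fr] := dF 0 (lexx 0) e e0; exists r => // h /[dup] hr /Fr.
  have /andP[h0 _] := hr.
  rewrite add0r !xD ?(ltW h0)//.
  suff -> : x 0 - S x 0 + F x h - (x 0 - S x 0 + F x 0) = F x h - F x 0 by [].
  by rewrite opprD addrACA subrr add0r.
- by apply: continuous_subspaceT; exact: continuous_f_segment.
Unshelve. all: by end_near. Qed.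

(** Freezing the time before [- Delta] extends a solution to the line without
    changing any segment [x_t] with [t >= 0]. *)
Lemma neutral_solution_extension (phi x : R -> 'cV[R]_n) :
  Cspace n Delta phi -> neutral_solution Delta delta A f phi x ->
  exists y, [/\ extended_solution y, forall s, - Delta <= s <= 0 -> y s = phi s &
    forall t, - Delta <= t -> y t = x t].
Proof.
move=> cphi [cx xphi dx dx0 _]; pose y t := x (Num.max (- Delta) t).
have yx t : - Delta <= t -> y t = x t by move=> Dt; rewrite /y (max_idPr Dt).
have cy : continuous y.
  refine (@continuous_comp_within R _ _ x _ cx (@continuous_maxl R (- Delta)) _).
  by move=> t; rewrite /= in_itv/= andbT le_max lexx.
have yD t : 0 <= t -> y t - S y t = Dop A delta (segment_at x t).
  have D0 := Delta0.
  move=> t0; rewrite Dop_segment yx; last by lra.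
  congr (_ - _); apply: delay_sum_eq => s.
  by move=> /andP[s1 _]; apply: yx; lra.
have fy t : 0 <= t -> f (segment_at y t) = f (segment_at x t).
  move=> t0.
  have E s : - Delta <= s <= 0 -> segment_at x t s = segment_at y t s.
    by move=> /andP[s1 _]; rewrite /segment_at yx//; lra.
  have c1 := Cspace_segment_at (d := Delta) (t := t) cy.
  apply: (lipschitz_eq fL c1) => [|s /E->//].
  exact: (Cspace_eq (continuous_segment_at cy) E).
exists y; split => //; last first.
  move=> s /[dup] sd /andP[s1 s2]; rewrite yx//; apply: xphi.
  by rewrite in_itv/= sd.
split => // t t0 e e0; rewrite fy//.
have : right_derivative_at (fun t => Dop A delta (segment_at x t)) t (f (segment_at x t)).
  have [->|tn0] := eqVneq t 0; first exact/right_derivative_cvg.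
  by apply: is_derive_right; apply: dx; rewrite lt_neqAle eq_sym tn0.
move=> /(_ e e0) [r r0 xr]; exists r => // h /[dup] /xr + /andP[h0 _].
by rewrite !yD// addr_ge0// ltW.
Qed.

Lemma segment_at_add (x : R -> 'cV[R]_n) (t h : R) :
  segment_at (segment_at x t) h = segment_at x (t + h).
Proof. by apply/funext => s; rewrite /segment_at addrA. Qed.

Lemma extended_solution_shift (x : R -> 'cV[R]_n) (t : R) : 0 <= t ->
  extended_solution x -> extended_solution (segment_at x t).
Proof.
move=> t0 [cx dx]; split; first exact: continuous_segment_at.
move=> s s0 e e0; rewrite segment_at_add.
have [r r0 xr] := dx _ (addr_ge0 t0 s0) e e0; exists r => // h /xr.
have SE u : S (segment_at x t) u = S x (t + u).
  by apply: eq_bigr => j _; rewrite /segment_at addrA.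
by rewrite !SE /segment_at !addrA.
Qed.

(** The difference [z] of two solutions satisfies
    [z t = delay_sum z t + D z_0 + (D z_t - D z_0)].  The first and the last term
    gain a factor 1/4 each in the weighted norm, so any bound for [z] improves.
    That [x1] and [x2] are bounded supplies the first bound. *)
Lemma solution_dependence (x1 x2 : R -> 'cV[R]_n) (B m : R) :
  extended_solution x1 -> extended_solution x2 ->
  (forall t, 0 <= t -> `|x1 t| <= B) -> (forall t, 0 <= t -> `|x2 t| <= B) ->
  (forall s, - Delta <= s <= 0 -> `|x1 s - x2 s| <= m) ->
  forall t, 0 <= t -> `|x1 t - x2 t| <= (2 + 2 * a) * m / (1 - 2^-1) * expR (g * t).
Proof.
move=> [c1 d1] [c2 d2] B1 B2 xm.
have D0 := Delta0; have a0' := a0.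
have m0 : 0 <= m.
  by apply: le_trans (normr_ge0 _) (xm 0 _); rewrite lexx oppr_le0 ltW.
have am : 0 <= a * m by rewrite mulr_ge0.
have E1 t : 0 <= t -> 1 <= expR (g * t).
  by move=> t0; rewrite -expR0 ler_expR mulr_ge0// ltW.
apply: (weighted_bound_improve (z := x1 \- x2)).
- by apply/andP; split; lra.
- by rewrite mulr_ge0//; lra.
- have B0 : 0 <= B by exact: le_trans (normr_ge0 _) (B1 0 (lexx 0)).
  exists (B + B) => [|t t0]; first exact: addr_ge0.
  apply: (@le_trans _ _ (B + B)).
    by apply: le_trans (ler_normB _ _) _; rewrite lerD// ?B1// B2.
  by rewrite ler_peMr ?addr_ge0// E1.
move=> C C0 zC t t0.
have -> : (x1 \- x2) t = S (x1 \- x2) t + ((x1 \- x2) 0 - S (x1 \- x2) 0) +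
    (((x1 t - S x1 t) - (x2 t - S x2 t)) - ((x1 0 - S x1 0) - (x2 0 - S x2 0))).
  rewrite (subrACA (x1 t)) (subrACA (x1 0)) -!delay_sumB [RHS]addrC.
  by rewrite -[X in X + _]addrA -opprD subrK.
have h1 : `|S (x1 \- x2) t| <= a * m + 4^-1 * C * expR (g * t).
  exact: delay_sum_weighted.
have h2 : `|(x1 \- x2) 0 - S (x1 \- x2) 0| <= m + a * m.
  apply: le_trans (ler_normB _ _) _; rewrite lerD//.
    by apply: xm; rewrite lexx oppr_le0 ltW.
  apply: (delay_sum_le m0) => s /andP[s1 s2]; apply: xm.
  by have := dm0; move: s1 s2 => s1 s2 d0; apply/andP; split; lra.
have h3 : `|((x1 t - S x1 t) - (x2 t - S x2 t)) - ((x1 0 - S x1 0) - (x2 0 - S x2 0))|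
    <= L * (m + C) / g * expR (g * t).
  apply: (expR_mean_value g0 _ (u := (fun s => x1 s - S x1 s) \- (fun s => x2 s - S x2 s))
    (d := fun t => f (segment_at x1 t) - f (segment_at x2 t))) => //.
  - by rewrite mulr_ge0// addr_ge0.
  - move=> s; apply: cvgB; apply: cvgB;
      [exact: c1|exact: continuous_delay_sum|exact: c2|exact: continuous_delay_sum].
  - by move=> s s0; apply: right_derivativeB; [exact: d1|exact: d2].
  - move=> s s0; rewrite -mulrA; apply: fL; try exact: Cspace_segment_at.
    move=> r /andP[r1 r0]; rewrite /segment_at.
    have Es := E1 s s0.
    have CE : 0 <= C * expR (g * s) by rewrite mulr_ge0// expR_ge0.
    have mE : m <= m * expR (g * s) by rewrite ler_peMr.
    have [sr|/ltW sr] := leP (s + r) 0.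
      by apply: le_trans (xm _ _) _; [apply/andP; split; lra|lra].
    apply: le_trans (zC _ sr) _.
    have : C * expR (g * (s + r)) <= C * expR (g * s).
      rewrite ler_wpM2l// ler_expR ler_wpM2l//; first exact: ltW.
      by lra.
    lra.
have h4 : L * (m + C) / g * expR (g * t) <= 4^-1 * ((m + C) * expR (g * t)).
  have -> : L * (m + C) / g * expR (g * t) = L / g * ((m + C) * expR (g * t)) by ring.
  by rewrite ler_wpM2r// mulr_ge0 ?expR_ge0// addr_ge0.
have mE : m <= m * expR (g * t) by rewrite ler_peMr// E1.
have amE : a * m <= a * m * expR (g * t) by rewrite ler_peMr// E1.
apply: le_trans (ler_normD _ _) _; apply: le_trans (lerD (ler_normD _ _) (lexx _)) _.
lra.
Qed.

(** For [h] below the smallest delay, [phi_h s] at [s > - h] is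
    [D phi + (h + s) * f phi] plus the difference terms of the true solution, which
    still lie in the history.  So [phi_h - x_h] is the error of the first order
    expansion of [D x_t] at time 0. *)
Lemma phi_shift_solution (phi x : R -> 'cV[R]_n) (e : R) :
  extended_solution x -> (forall s, - Delta <= s <= 0 -> phi s = x s) -> 0 < e ->
  exists2 eta : R, 0 < eta & forall h, 0 < h < eta ->
    Cspace n Delta (phi_shift delta A f phi h) /\
    forall s, - Delta <= s <= 0 ->
      `|phi_shift delta A f phi h s - segment_at x h s| <= e * h.
Proof.
move=> [cx dx] phix e0.
have D0 := Delta0; have dm0' := dm0.
have cphi : Cspace n Delta phi by exact: Cspace_eq cx phix.
have [r r0 xr] := dx 0 (lexx 0) e e0.
exists (Num.min r dm) => [|h /andP[h0]]; first by rewrite lt_min r0.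
rewrite lt_min => /andP[hr hd].
have fphi : f phi = f (segment_at x 0).
  have -> : segment_at x 0 = x by apply/funext => s; rewrite /segment_at add0r.
  apply: (lipschitz_eq fL) => //.
  by apply: (Cspace_eq cx).
have Dphi : Dop A delta phi = x 0 - S x 0.
  rewrite /Dop /delay_sum phix; last by rewrite lexx oppr_le0 ltW.
  congr (_ - _); apply: eq_bigr => j _; rewrite sub0r phix//.
  by have /andP[d1 d2] := dmD j; apply/andP; split; lra.
(* one formula for both pieces of [phi_h], which shows that they fit together continuously *)
pose Y t := x (Num.min t 0) + (S x (Num.max 0 t) - S x 0) + Num.max 0 t *: f phi.
have cY : continuous Y.
  move=> t; apply: cvgD; [apply: cvgD|].
  - exact: (continuous_comp (continuous_minr (c := 0) (x := t)) (cx (Num.min t 0))).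
  - apply: cvgB; last exact: cvg_cst.
    exact: (continuous_comp (continuous_maxl (c := 0) (x := t))
      (continuous_delay_sum (A := A) (delta := delta) cx (x := Num.max 0 t))).
  - by apply: cvgZr_tmp; exact: continuous_maxl.
have Yl t : t <= 0 -> Y t = x t.
  by move=> t0; rewrite /Y (min_idPl t0) (max_idPl t0) subrr addr0 scale0r addr0.
have Yr t : 0 <= t -> Y t = x 0 + (S x t - S x 0) + t *: f phi.
  by move=> t0; rewrite /Y (min_idPr t0) (max_idPr t0).
have shiftE s : - Delta <= s <= 0 -> phi_shift delta A f phi h s = Y (h + s).
  move=> /andP[s1 s2]; rewrite /phi_shift; case: ifPn => [sh|].
    by rewrite phix ?Yl ?[s + h]addrC//; [lra|apply/andP; split; lra].
  rewrite -ltNge => sh; have hs0 : 0 <= h + s by lra.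
  have -> : Dop A delta (phi_star phi (s + h)) = x 0 - S x (h + s).
    rewrite /Dop /delay_sum /phi_star ifF; last by apply/negbTE; rewrite -ltNge; lra.
    rewrite phix; last by rewrite lexx oppr_le0 ltW.
    congr (_ - _); apply: eq_bigr => j _.
    have /andP[d1 d2] := dmD j.
    rewrite ifT; last by lra.
    rewrite phix; last by apply/andP; split; lra.
    by congr (_ *m x _); ring.
  rewrite Yr// Dphi phix; last by rewrite lexx oppr_le0 ltW.
  rewrite [s + h]addrC opprB -[LHS]addrA subrK addrAC; congr (_ + _).
  by rewrite -addrA [- _ + _]addrC.
split.
  exact: (Cspace_eq (continuous_segment_at cY) shiftE).
move=> s /[dup] sd /andP[s1 s2]; rewrite shiftE// /segment_at.
have [hs|hs] := leP (h + s) 0.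
  by rewrite Yl// subrr normr0 mulr_ge0// ltW.
have hsr : 0 < h + s < r by apply/andP; split; lra.
have := xr _ hsr; rewrite add0r -fphi => xrs; rewrite Yr ?(ltW hs)// distrC.
apply: (@le_trans _ _ (e * (h + s))); last by rewrite ler_wpM2l ?(ltW e0)//; lra.
apply: le_trans xrs.
suff -> : x (h + s) - (x 0 + (S x (h + s) - S x 0) + (h + s) *: f phi) =
  x (h + s) - S x (h + s) - (x 0 - S x 0) - (h + s) *: f phi by [].
by rewrite opprD addrA; congr (_ - _); rewrite subrACA opprD addrA.
Qed.

(** * Lyapunov functionals imply exponential decay *)

(** [phi_shift_solution] turns the derivative along [phi_h] into a right Dini
    derivative of [t |-> V x_t]; [dini_nonincreasing] applies to
    [expR (a3 * t) * V x_t]. *)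
Lemma lyapunov_decay (V : (R -> 'cV[R]_n) -> R) (K a3 : R) (x : R -> 'cV[R]_n) :
  0 <= K -> 0 < a3 ->
  (forall phi, Cspace n Delta phi -> 0 <= V phi) ->
  sup_lipschitz Delta K V ->
  (forall phi, Cspace n Delta phi ->
    (Dplus delta A f V phi <= (- a3 * V phi)%:E)%E) ->
  extended_solution x ->
  forall t, 0 <= t -> V (segment_at x t) <= expR (- (a3 * t)) * V (segment_at x 0).
Proof.
move=> K0 a30 V0 VK VD solx t t0; have [cx _] := solx.
pose v t := V (segment_at x t).
have cseg s : Cspace n Delta (segment_at x s) by exact: Cspace_segment_at.
have v0 s : 0 <= v s by exact: (V0 _ (cseg s)).
suff : expR (a3 * t) * v t <= expR (a3 * 0) * v 0.
  by rewrite mulr0 expR0 mul1r expRN -/(v t) -/(v 0) ler_pdivlMl ?expR_gt0.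
apply: (dini_nonincreasing (g := fun t => expR (a3 * t) * v t)) t0 => {t}[t|t t0 e e0].
  apply: cvgM; last exact: (continuous_lipschitz_segment K0 VK cx).
  by apply: continuous_comp; [exact: mulrl_continuous|exact: continuous_expR].
(* [expR a3] bounds [expR (a3 * h)] for [h <= 1] *)
pose E := expR (a3 * t) * expR a3.
have E0 : 0 < E by rewrite mulr_gt0 ?expR_gt0.
pose e' := e / E; have e'0 : 0 < e' by rewrite divr_gt0.
have e20 : 0 < e' / 2 by rewrite divr_gt0.
have [r1 r10 vD] := (limf_esup_right_leP _ _).1 (VD _ (cseg t)) _ e20.
have K1 : 0 < 2 * (K + 1) by lra.
have e30 : 0 < e' / (2 * (K + 1)) by rewrite divr_gt0.
have [|r2 r20 shD] := phi_shift_solution (phi := segment_at x t)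
  (extended_solution_shift t0 solx) _ e30; first by [].
exists (Num.min 1 (Num.min r1 r2)); first by rewrite !lt_min ltr01 r10.
move=> h /andP[h0]; rewrite !lt_min => /and3P[h1 hr1 hr2].
have := vD h; rewrite h0 hr1 => /(_ isT); rewrite ler_pdivrMr// => {}vD.
have := shD h; rewrite h0 hr2 => /(_ isT)[csh {}shD].
have c2 : Cspace n Delta (segment_at (segment_at x t) h).
  by rewrite segment_at_add; exact: (cseg (t + h)).
have := VK _ _ _ csh c2 shD.
rewrite segment_at_add -/(v (t + h)) distrC => /(le_trans (ler_norm _)) vsh.
have Ke : K * (e' / (2 * (K + 1)) * h) <= e' / 2 * h.
  rewrite mulrA ler_wpM2r ?(ltW h0)// mulrA ler_pdivrMr//; nra.
have {vsh} vth : v (t + h) <= v t - a3 * v t * h + e' * h.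
  by move: vD vsh Ke; rewrite -/(v t); lra.
have Eh : expR (a3 * h) * (1 - a3 * h) <= 1.
  rewrite -ler_pdivlMl ?expR_gt0// mulr1 -expRN.
  exact: expR_ge1Dx.
have Eh1 : expR (a3 * h) <= expR a3.
  by rewrite ler_expR -[leRHS]mulr1 ler_wpM2l// ltW.
have -> : expR (a3 * (t + h)) = expR (a3 * t) * expR (a3 * h).
  by rewrite mulrDr expRD.
have -> : e * h = expR (a3 * t) * (expR a3 * (e' * h)).
  by rewrite /e' /E; field; rewrite !gt_eqF ?expR_gt0.
rewrite -mulrA -mulrDr ler_wpM2l ?expR_ge0//.
apply: (@le_trans _ _ (expR (a3 * h) * ((1 - a3 * h) * v t + e' * h))).
  by rewrite ler_wpM2l ?expR_ge0//; lra.
rewrite mulrDr mulrA lerD//.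
  by rewrite -[leRHS]mul1r ler_wpM2r.
by rewrite ler_wpM2r// mulr_ge0 ?ltW.
Qed.

(** Decay of [V x_t] bounds [D x_t], which is the forcing in the difference
    equation for [x]. *)
Lemma lyapunov_zero_GES (V : (R -> 'cV[R]_n) -> R) (K a1 a2 a3 : R) :
  (0 < n)%N -> difference_UAS A delta ->
  0 <= K -> 0 < a1 -> 0 < a2 -> 0 < a3 ->
  (forall phi, Cspace n Delta phi -> 0 <= V phi) ->
  sup_lipschitz Delta K V ->
  (forall phi, Cspace n Delta phi ->
    a1 * enorm (Dop A delta phi) <= V phi <= a2 * supnorm Delta phi) ->
  (forall phi, Cspace n Delta phi ->
    (Dplus delta A f V phi <= (- a3 * V phi)%:E)%E) ->
  zero_GES Delta delta A f.
Proof.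
move=> n0 uas K0 a10 a20 a30 V0 VK Vb VD.
have [M [lambda [M0 l0 dec]]] := forced_decay Delta0 uas a30.
have n0' : 0 < n%:R :> R by rewrite ltr0n.
have c0 : 0 < a2 / a1 by rewrite divr_gt0.
exists (n%:R * (M * (1 + a2 / a1))), lambda; split=> //.
  by rewrite !mulr_gt0// addr_gt0.
move=> phi cphi; split.
  exact: neutral_solution_exists.
move=> x /(neutral_solution_extension cphi)[y [soly yphi yx]] t t0.
have D0 := ltW Delta0; have [cy _] := soly.
rewrite -yx; last by apply: le_trans t0; rewrite oppr_le0.
have s0 : 0 <= supnorm Delta phi.
  by apply: le_trans (normr_ge0 _) (normv_le_supnorm D0 cphi (s := 0) _); rewrite lexx oppr_le0 D0.
have sc : 0 <= a2 / a1 * supnorm Delta phi by rewrite mulr_ge0// ltW.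
have yD s : y s - delay_sum A delta y s = Dop A delta (segment_at y s).
  by rewrite Dop_segment.
apply: le_trans (enorm_le_normv _) _; rewrite -!mulrA ler_wpM2l ?(ltW n0')//.
have -> : M * ((1 + a2 / a1) * (expR (- (lambda * t)) * supnorm Delta phi)) =
  M * expR (- (lambda * t)) * ((1 + a2 / a1) * supnorm Delta phi) by ring.
apply: (dec y (fun s => y s - delay_sum A delta y s)) => //.
- by move=> s; apply: cvgB; [exact: cy|exact: continuous_delay_sum].
- by rewrite mulr_ge0// addr_ge0// ltW.
- by move=> s _; rewrite addrC subrK.
- move=> s ss0; rewrite yD.
  have cseg r : Cspace n Delta (segment_at y r) by exact: Cspace_segment_at.
  have /andP[h1 _] := Vb _ (cseg s); have /andP[_ h2] := Vb _ (cseg 0).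
  have h3 := lyapunov_decay K0 a30 V0 VK VD soly ss0.
  have h4 : supnorm Delta (segment_at y 0) = supnorm Delta phi.
    by apply: supnorm_eq => r rd; rewrite /segment_at add0r yphi.
  apply: le_trans (normv_le_enorm _) _.
  rewrite h4 in h2.
  have E0 := expR_ge0 (- (a3 * s)).
  have h5 : enorm (Dop A delta (segment_at y s)) <=
      a2 / a1 * supnorm Delta phi * expR (- (a3 * s)).
    rewrite -(ler_pM2l a10); apply: le_trans h1 (le_trans h3 _).
    have -> : a1 * (a2 / a1 * supnorm Delta phi * expR (- (a3 * s))) =
      expR (- (a3 * s)) * (a2 * supnorm Delta phi) by field; rewrite gt_eqF.
    by rewrite ler_wpM2l.
  apply: le_trans h5 _; rewrite ler_wpM2r// mulrDl mul1r lerDr.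
  exact: s0.
- move=> s sd; rewrite yphi//; apply: le_trans (normv_le_supnorm D0 cphi sd) _.
  by rewrite mulrDl mul1r lerDl.
Qed.

(** * The converse: a functional built from the flow *)

Section converse.
Context (n0 : (0 < n)%N) (M lambda : R) (M0 : 0 < M) (lambda0 : 0 < lambda)
  (Y : (R -> 'cV[R]_n) -> R -> 'cV[R]_n)
  (YP : forall phi, Cspace n Delta phi ->
    [/\ extended_solution (Y phi), forall s, - Delta <= s <= 0 -> Y phi s = phi s &
     forall t, 0 <= t -> `|Y phi t| <= M * expR (- (lambda * t)) * supnorm Delta phi]).

Let l := lambda / 2.
Let l_gt0 : 0 < l. Proof. by rewrite divr_gt0. Qed.
Let lE : lambda = l + l. Proof. by rewrite /l; field. Qed.

Let n_gt0 : 0 < n%:R :> R. Proof. by rewrite ltr0n. Qed.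
Let Delta_ge0 : 0 <= Delta. Proof. exact: ltW. Qed.

Let supnorm_ge0 phi : Cspace n Delta phi -> 0 <= supnorm Delta phi.
Proof.
move=> cphi; apply: le_trans (normr_ge0 _) (normv_le_supnorm Delta_ge0 cphi (s := 0) _).
by apply/andP; split; rewrite ?oppr_le0 ?lexx.
Qed.

Definition flow_weight (phi : R -> 'cV[R]_n) (t : R) : R :=
  expR (l * t) * `|Y phi t|.

(** Starting the supremum at [- Delta] rather than 0 makes [V] control the whole
    history; the Lipschitz estimate uses this at large times. *)
Definition flow_functional (phi : R -> 'cV[R]_n) : R :=
  sup [set flow_weight phi t | t in [set t | - Delta <= t]].

Local Notation V := flow_functional.

(** On [[-Delta, 0]] the weight is at most 1; afterwards the decay of the solution
    is twice as fast as the growth of the weight. *)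
Lemma flow_weight_le phi t : Cspace n Delta phi -> - Delta <= t ->
  flow_weight phi t <= (M + 1) * supnorm Delta phi.
Proof.
move=> cphi tD; have [_ Yphi YM] := YP cphi; have s0 := supnorm_ge0 cphi.
have Ms : 0 <= M * supnorm Delta phi by rewrite mulr_ge0// ltW.
have [t0|/ltW t0] := leP t 0.
  have E1 : expR (l * t) <= 1 by rewrite -expR0 ler_expR pmulr_rle0.
  have tD0 : - Delta <= t <= 0 by rewrite tD t0.
  have := normv_le_supnorm Delta_ge0 cphi tD0; rewrite -(Yphi _ tD0) => Ys.
  have : flow_weight phi t <= `|Y phi t| by rewrite /flow_weight ler_piMl.
  by lra.
have E1 : expR (- (l * t)) <= 1 by rewrite -expR0 ler_expR oppr_le0 mulr_ge0// ltW.
have : flow_weight phi t <= expR (- (l * t)) * (M * supnorm Delta phi).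
  have EE : expR (- (l * t)) = expR (l * t) * expR (- (lambda * t)).
    by rewrite -expRD; congr expR; rewrite lE; ring.
  rewrite EE -mulrA ler_wpM2l ?expR_ge0//; apply: le_trans (YM t t0) _.
  by rewrite mulrCA mulrA.
have : expR (- (l * t)) * (M * supnorm Delta phi) <= M * supnorm Delta phi.
  by rewrite ler_piMl.
by lra.
Qed.

Lemma flow_functional_ub phi t : Cspace n Delta phi -> - Delta <= t ->
  flow_weight phi t <= V phi.
Proof.
move=> cphi tD; apply: ub_le_sup; last by exists t.
by exists ((M + 1) * supnorm Delta phi) => _ [s sD <-]; exact: flow_weight_le.
Qed.

Lemma flow_functional_le phi c :
  (forall t, - Delta <= t -> flow_weight phi t <= c) -> V phi <= c.
Proof.
move=> Zc; apply: ge_sup.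
  by exists (flow_weight phi 0), 0 => //=; rewrite oppr_le0.
by move=> _ [s sD <-]; exact: Zc.
Qed.

Lemma flow_functional_ge0 phi : Cspace n Delta phi -> 0 <= V phi.
Proof.
move=> cphi; apply: le_trans (flow_functional_ub (t := 0) cphi _).
  by rewrite mulr_ge0 ?expR_ge0.
by rewrite oppr_le0.
Qed.

Let ED := expR (l * Delta).
Let ED_ge1 : 1 <= ED.
Proof. by rewrite -expR0 ler_expR mulr_ge0// ltW. Qed.

Lemma normv_le_flow_functional phi s : Cspace n Delta phi -> - Delta <= s <= 0 ->
  `|phi s| <= ED * V phi.
Proof.
move=> cphi /[dup] sd /andP[s1 s2]; have [_ Yphi _] := YP cphi.
rewrite -(Yphi _ sd); apply: (@le_trans _ _ (ED * flow_weight phi s)); last first.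
  by rewrite ler_wpM2l ?expR_ge0//; exact: flow_functional_ub.
rewrite /flow_weight mulrA -expRD -mulrDr ler_peMl// -expR0 ler_expR mulr_ge0//.
  exact: ltW.
by lra.
Qed.

(** After this time the weighted norm of a solution is below its maximum over
    [[-Delta, 0]]; the value makes [MT] true through [expR x >= 1 + x]. *)
Let T := M * n%:R * ED / l.

Let T_ge0 : 0 <= T.
Proof.
by rewrite /T divr_ge0 ?(ltW l_gt0)// mulr_ge0 ?expR_ge0// mulr_ge0 ?(ltW M0)// ler0n.
Qed.

Let MT : M * n%:R * ED * expR (- (l * T)) <= 1.
Proof.
rewrite expRN ler_pdivrMr ?expR_gt0// mul1r.
apply: le_trans (expR_ge1Dx _).
by rewrite /T mulrCA divff ?gt_eqF// mulr1 lerDr.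
Qed.

Let K0 := (2 + 2 * a) / (1 - 2^-1).
Let K0_ge0 : 0 <= K0. Proof. by have a0' := a0; rewrite divr_ge0; lra. Qed.

Let K := 1 + expR (l * T) * (1 + K0 * expR (g * T)).

Let KT0 : 0 <= expR (l * T) * (1 + K0 * expR (g * T)).
Proof. by rewrite mulr_ge0 ?expR_ge0// addr_ge0// mulr_ge0// expR_ge0. Qed.

Let K_gt0 : 0 < K. Proof. by have KT := KT0; rewrite /K; lra. Qed.

Let decayed_le phi s : Cspace n Delta phi -> 0 <= s ->
  M * expR (- (lambda * s)) * supnorm Delta phi <= M * supnorm Delta phi.
Proof.
move=> cphi s0; rewrite ler_wpM2r ?supnorm_ge0// ler_piMr ?(ltW M0)//.
by rewrite -expR0 ler_expR oppr_le0 mulr_ge0// ltW.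
Qed.

Let bound_ge0 phi : Cspace n Delta phi -> 0 <= M * supnorm Delta phi.
Proof. by move=> cphi; rewrite mulr_ge0 ?supnorm_ge0// ltW. Qed.

(** Exponential stability provides the boundedness that
    [solution_dependence] asks for. *)
Lemma flow_dependence phi1 phi2 m t : Cspace n Delta phi1 -> Cspace n Delta phi2 ->
  (forall s, - Delta <= s <= 0 -> `|phi1 s - phi2 s| <= m) -> 0 <= t ->
  `|Y phi1 t - Y phi2 t| <= K0 * m * expR (g * t).
Proof.
move=> c1 c2 pm t0.
have [sol1 Y1 M1] := YP c1; have [sol2 Y2 M2] := YP c2.
have B1 := bound_ge0 c1; have B2 := bound_ge0 c2.
rewrite /K0 [_ / _ * m]mulrAC.
apply: (solution_dependence
  (B := M * supnorm Delta phi1 + M * supnorm Delta phi2) sol1 sol2) => //.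
- by move=> s s0; apply: le_trans (M1 s s0) _; have := decayed_le c1 s0; lra.
- by move=> s s0; apply: le_trans (M2 s s0) _; have := decayed_le c2 s0; lra.
- by move=> s sd; rewrite Y1// Y2//; exact: pm.
Qed.

(** Up to time [T] the two solutions are close.  After time [T] the weighted
    norm of the first solution is below the initial part of the supremum, and
    there the initial functions can be compared. *)
Let flow_functional_le_add phi1 phi2 m :
  Cspace n Delta phi1 -> Cspace n Delta phi2 ->
  (forall s, - Delta <= s <= 0 -> `|phi1 s - phi2 s| <= m) ->
  V phi1 <= V phi2 + K * m.
Proof.
move=> c1 c2 pm; apply: flow_functional_le => t tD.
have m0 : 0 <= m.
  apply: le_trans (normr_ge0 _) (pm 0 _).
  by apply/andP; split; rewrite ?oppr_le0 ?lexx.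
have [_ Y1 M1] := YP c1; have [_ Y2 M2] := YP c2.
have [tT|/ltW Tt] := leP t T.
  have Yd : `|Y phi1 t - Y phi2 t| <= (1 + K0 * expR (g * T)) * m.
    have KE : 0 <= K0 * expR (g * T) * m.
      by rewrite mulr_ge0// mulr_ge0// expR_ge0.
    have [t0|/ltW t0] := leP t 0.
      have td : - Delta <= t <= 0 by rewrite tD t0.
      by rewrite Y1// Y2//; have := pm t td; lra.
    apply: le_trans (flow_dependence c1 c2 pm t0) _.
    have : K0 * m * expR (g * t) <= K0 * m * expR (g * T).
      have K0m : 0 <= K0 * m by rewrite mulr_ge0.
      by rewrite ler_wpM2l// ler_expR ler_wpM2l// ltW.
    by lra.
  have h1 : flow_weight phi1 t <=
      flow_weight phi2 t + expR (l * t) * `|Y phi1 t - Y phi2 t|.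
    rewrite /flow_weight -mulrDr ler_wpM2l ?expR_ge0// addrC.
    by rewrite -[X in `|X| <= _](subrK (Y phi2 t)) ler_normD.
  have h2 : expR (l * t) * `|Y phi1 t - Y phi2 t| <=
      expR (l * T) * ((1 + K0 * expR (g * T)) * m).
    by apply: ler_pM => //; rewrite ?expR_ge0// ler_expR ler_wpM2l// ltW.
  have h3 := flow_functional_ub c2 tD.
  by move: h1 h2 h3; rewrite /K; lra.
have t0 : 0 <= t by exact: le_trans Tt.
have s1 : supnorm Delta phi1 <= n%:R * (ED * V phi2 + m).
  apply: supnorm_le => // s sd; rewrite -[phi1 s](subrK (phi2 s)) addrC.
  apply: le_trans (ler_normD _ _) _.
  by rewrite lerD//; [exact: normv_le_flow_functional|exact: pm].
have EE : expR (l * t) * (M * expR (- (lambda * t))) = M * expR (- (l * t)).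
  by rewrite mulrCA -expRD; congr (_ * expR _); rewrite lE; ring.
have Et : expR (- (l * t)) <= expR (- (l * T)).
  by rewrite ler_expR lerN2 ler_wpM2l// ltW.
have h1 : flow_weight phi1 t <= M * expR (- (l * T)) * (n%:R * (ED * V phi2 + m)).
  apply: (@le_trans _ _ (M * expR (- (l * t)) * supnorm Delta phi1)).
    by rewrite -EE -mulrA ler_wpM2l ?expR_ge0//; exact: M1.
  apply: ler_pM => //; first by rewrite mulr_ge0 ?expR_ge0// ltW.
    exact: supnorm_ge0.
  by rewrite ler_wpM2l// ltW.
have Vp := flow_functional_ge0 c2.
have h2 : M * expR (- (l * T)) * (n%:R * (ED * V phi2 + m)) <=
    M * n%:R * ED * expR (- (l * T)) * (V phi2 + m).
  have -> : M * n%:R * ED * expR (- (l * T)) * (V phi2 + m) =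
    M * expR (- (l * T)) * (n%:R * (ED * V phi2 + ED * m)) by ring.
  rewrite ler_wpM2l ?mulr_ge0 ?expR_ge0 ?(ltW M0)// ler_wpM2l ?(ltW n_gt0)//.
  by rewrite lerD2l ler_peMl.
have h3 : M * n%:R * ED * expR (- (l * T)) * (V phi2 + m) <= V phi2 + m.
  by rewrite ler_piMl// addr_ge0.
have : 0 <= expR (l * T) * (1 + K0 * expR (g * T)) * m by rewrite mulr_ge0.
by move: h1 h2 h3; rewrite /K; lra.
Qed.

(** The one-sided estimate is symmetric in [phi1] and [phi2]. *)
Lemma flow_functional_lipschitz : sup_lipschitz Delta K V.
Proof.
move=> phi1 phi2 m c1 c2 pm; rewrite ler_norml.
have h1 := flow_functional_le_add c1 c2 pm.
have h2 : V phi2 <= V phi1 + K * m.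
  by apply: flow_functional_le_add => // s sd; rewrite distrC; exact: pm.
by apply/andP; split; lra.
Qed.

(** By uniqueness the solution that starts from [x_h] is [x] shifted by [h], and
    the shift multiplies the weight by [expR (- (l * h))]. *)
Lemma flow_functional_segment phi h : Cspace n Delta phi -> 0 <= h ->
  V (segment_at (Y phi) h) <= expR (- (l * h)) * V phi.
Proof.
move=> cphi h0; have [soly Yphi YM] := YP cphi; have [cy _] := soly.
have cseg : Cspace n Delta (segment_at (Y phi) h) by exact: Cspace_segment_at.
have [solz Zphi ZM] := YP cseg.
apply: flow_functional_le => t tD.
have -> : flow_weight (segment_at (Y phi) h) t =
    expR (- (l * h)) * flow_weight phi (h + t).
  have -> : flow_weight phi (h + t) = expR (l * (h + t)) * `|Y phi (h + t)| by [].
  rewrite /flow_weight mulrA -expRD.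
  rewrite (_ : - (l * h) + l * (h + t) = l * t); last by ring.
  suff -> : Y (segment_at (Y phi) h) t = Y phi (h + t) by [].
  have [t0|/ltW t0] := leP t 0; first by rewrite Zphi// tD.
  apply/eqP; rewrite -subr_eq0 -normr_le0 -/(segment_at (Y phi) h t).
  have B1 := bound_ge0 cphi; have B2 := bound_ge0 cseg.
  rewrite (_ : 0 = (2 + 2 * a) * 0 / (1 - 2^-1) * expR (g * t)); last first.
    by rewrite mulr0 !mul0r.
  apply: (solution_dependence
    (B := M * supnorm Delta phi + M * supnorm Delta (segment_at (Y phi) h))
    solz (extended_solution_shift h0 soly)) => // [s s0|s s0|s sd].
  - by apply: le_trans (ZM s s0) _; have := decayed_le cseg s0; lra.
  - apply: le_trans (YM _ (addr_ge0 h0 s0)) _.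
    by have := decayed_le cphi (addr_ge0 h0 s0); lra.
  - by rewrite Zphi// subrr normr0.
by rewrite ler_wpM2l ?expR_ge0//; apply: flow_functional_ub => //; lra.
Qed.

Lemma Dop_le_flow_functional phi : Cspace n Delta phi ->
  (n%:R * ((1 + a) * ED))^-1 * enorm (Dop A delta phi) <= V phi.
Proof.
move=> cphi; have a0' := a0.
rewrite ler_pdivrMl; last by rewrite !mulr_gt0 ?expR_gt0//; lra.
apply: le_trans (enorm_le_normv _) _; rewrite -mulrA ler_wpM2l ?(ltW n_gt0)//.
rewrite -mulrA mulrDl mul1r; apply: le_trans (ler_normB _ _) _.
have pV : 0 <= ED * V phi by rewrite mulr_ge0 ?expR_ge0 ?flow_functional_ge0.
apply: lerD.
  by apply: normv_le_flow_functional => //; rewrite oppr_le0 Delta_ge0 lexx.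
apply: aP => // j; apply: normv_le_flow_functional => //.
by have /andP[d1 d2] := dmD j; have d0 := dm0; apply/andP; split; lra.
Qed.

(** The rate is halved a second time so that
    [expR (- (l * h)) <= 1 - l / 2 * h] holds for all [h <= 1 / l], which avoids a
    limit argument. *)
Lemma Dplus_flow_functional phi : Cspace n Delta phi ->
  (Dplus delta A f V phi <= (- (l / 2) * V phi)%:E)%E.
Proof.
move=> cphi; have [soly Yphi _] := YP cphi; have [cy _] := soly.
apply/limf_esup_right_leP => e e0.
have e'0 : 0 < e / K by rewrite divr_gt0.
have [|r r0 shD] := phi_shift_solution (phi := phi) soly _ e'0.
  by move=> s sd; rewrite Yphi.
exists (Num.min r l^-1); first by rewrite lt_min r0 invr_gt0.
move=> h /andP[h0]; rewrite lt_min => /andP[hr hl].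
have := shD h; rewrite h0 hr => /(_ isT)[csh {}shD].
have cseg : Cspace n Delta (segment_at (Y phi) h) by exact: Cspace_segment_at.
have h1 := flow_functional_le_add csh cseg shD.
have Ke : K * (e / K * h) = e * h by field; rewrite gt_eqF.
have h2 := flow_functional_segment cphi (ltW h0).
have lh : l * h <= 1.
  by rewrite -ler_pdivlMl// mulr1 ltW.
have lh0 : 0 <= l * h by rewrite mulr_ge0 ?ltW.
have h3 : expR (- (l * h)) <= 1 - l / 2 * h.
  rewrite expRN -[leLHS]mul1r ler_pdivrMr ?expR_gt0//.
  have := expR_ge1Dx (l * h); nra.
have h4 : expR (- (l * h)) * V phi <= (1 - l / 2 * h) * V phi.
  by rewrite ler_wpM2r// flow_functional_ge0.
rewrite ler_pdivrMr//.
by move: h1; rewrite Ke; lra.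
Qed.

Lemma flow_functional_lyapunov :
  exists (V : (R -> 'cV[R]_n) -> R) (K a1 a2 a3 : R),
    [/\ 0 < K /\ sup_lipschitz Delta K V, [/\ 0 < a1, 0 < a2 & 0 < a3],
     forall phi, Cspace n Delta phi -> 0 <= V phi,
     forall phi, Cspace n Delta phi ->
       a1 * enorm (Dop A delta phi) <= V phi <= a2 * supnorm Delta phi &
     forall phi, Cspace n Delta phi ->
       (Dplus delta A f V phi <= (- a3 * V phi)%:E)%E].
Proof.
exists V, K, (n%:R * ((1 + a) * ED))^-1, (M + 1), (l / 2); split.
- by split => //; exact: flow_functional_lipschitz.
- split; [|by rewrite addr_gt0|by rewrite divr_gt0].
  by rewrite invr_gt0 !mulr_gt0 ?expR_gt0// ltr_wpDr.
- exact: flow_functional_ge0.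
- move=> phi cphi; apply/andP; split; first exact: Dop_le_flow_functional.
  by apply: flow_functional_le => t tD; exact: flow_weight_le.
- exact: Dplus_flow_functional.
Qed.

End converse.

Lemma zero_GES_lyapunov : (0 < n)%N -> zero_GES Delta delta A f ->
  exists (V : (R -> 'cV[R]_n) -> R) (K a1 a2 a3 : R),
    [/\ 0 < K /\ sup_lipschitz Delta K V, [/\ 0 < a1, 0 < a2 & 0 < a3],
     forall phi, Cspace n Delta phi -> 0 <= V phi,
     forall phi, Cspace n Delta phi ->
       a1 * enorm (Dop A delta phi) <= V phi <= a2 * supnorm Delta phi &
     forall phi, Cspace n Delta phi ->
       (Dplus delta A f V phi <= (- a3 * V phi)%:E)%E].
Proof.
move=> n0 [M [lambda [M0 l0 ges]]].
have /choice[Y YP] : forall phi, exists y : R -> 'cV[R]_n, Cspace n Delta phi ->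
    [/\ extended_solution y, forall s, - Delta <= s <= 0 -> y s = phi s &
     forall t, 0 <= t -> `|y t| <= M * expR (- (lambda * t)) * supnorm Delta phi].
  move=> phi; have [cphi|nc] := pselect (Cspace n Delta phi); last by exists (fun=> 0).
  have [[x solx] xM] := ges phi cphi.
  have [y [soly yphi yx]] := neutral_solution_extension cphi solx.
  exists y => _; split => // t t0; rewrite yx; last first.
    by apply: le_trans t0; rewrite oppr_le0 ltW.
  exact: le_trans (normv_le_enorm _) (xM x solx t t0).
exact (flow_functional_lyapunov n0 M0 l0 YP).
Qed.

End neutral_system.

Lemma delay_lower_bound (R : realType) (p : nat) (Delta : R) (delta : 'I_p -> R) :
  0 < Delta -> (forall j, 0 < delta j <= Delta) ->
  exists2 dm : R, 0 < dm & forall j, dm <= delta j <= Delta.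
Proof.
move=> D0 dD; exists (\big[Num.min/Delta]_(j < p) delta j).
  by apply: lt_bigmin => // j _; have /andP[] := dD j.
by move=> j; have /andP[_ ->] := dD j; rewrite andbT; exact: bigmin_le.
Qed.

Theorem theorem3 (R : realType) (n p : nat) (Delta : R) (delta : 'I_p -> R)
    (A : 'I_p -> 'M[R]_n) (f : (R -> 'cV[R]_n) -> 'cV[R]_n)
    (n_gt0 : (0 < n)%N) (p_gt0 : (0 < p)%N) (Delta_gt0 : 0 < Delta)
    (delta_bound : forall j, 0 < delta j <= Delta)
    (f_lip : globally_lipschitz Delta (@enorm R n) f)
    (f0 : f (fun=> 0) = 0)
    (D_stable : strongly_stable A) :
  zero_GES Delta delta A f <->
  exists V : (R -> 'cV[R]_n) -> R, exists a1 a2 a3 : R,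
    [/\ forall phi, Cspace n Delta phi -> 0 <= V phi,
        globally_lipschitz Delta (fun v : R => `|v|) V,
        [/\ 0 < a1, 0 < a2 & 0 < a3],
        forall phi, Cspace n Delta phi ->
          a1 * enorm (Dop A delta phi) <= V phi <= a2 * supnorm Delta phi &
        forall phi, Cspace n Delta phi ->
          (Dplus delta A f V phi <= (- a3 * V phi)%:E)%E].
Proof.
have [dm dm0 dmD] := delay_lower_bound Delta_gt0 delta_bound.
have [a a0 aP] := mulmx_sum_bound A.
have [L L0 fL] := globally_lipschitz_normv (ltW Delta_gt0) (@normv_le_enorm R n) f_lip.
have [g [g0 ag Lg]] := weight_rate a0 dm0 L0.
have uas : difference_UAS A delta.
  by apply: D_stable => j; have /andP[] := delta_bound j.
split=> [ges|[V [a1 [a2 [a3 [V0 V_lip [a10 a20 a30] Vb VD]]]]]].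
  have [V [K [a1 [a2 [a3 [[K0 VK] apos V0 Vb VD]]]]]] :=
    zero_GES_lyapunov dm0 dmD a0 aP g0 ag Delta_gt0 L0 fL Lg n_gt0 ges.
  exists V, a1, a2, a3; split => //.
  exists K => // phi1 phi2 c1 c2; apply: VK => // s sd.
  have c12 : Cspace n Delta (phi1 \- phi2) by exact: (CspaceB (ltW Delta_gt0) c1 c2).
  exact: (normv_le_supnorm (ltW Delta_gt0) c12 sd).
have [K K0 VK] := globally_lipschitz_normv (ltW Delta_gt0) (fun v : R => lexx `|v|) V_lip.
exact: (lyapunov_zero_GES dm0 dmD a0 aP g0 ag Delta_gt0 L0 fL f0 Lg n_gt0 uas
  K0 a10 a20 a30 V0 VK Vb VD).
Qed.
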